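(* Let $1<\alpha<2$, $0<p<1$, and for $(t,s)\in\mathbb{R}^2$ put $w:=(|t|^{1/p}+|s|^{1/(1-p)})^p$. Define, for $z\in[-1,1]$, $$b(z):=c_f\int_0^\infty\operatorname{leb}\Big(B\cap\Big(B+\big(z/r^p,\,(1-|z|^{1/p})^{1-p}/r^{1-p}\big)\Big)\Big)r^{-\alpha}\,dr.$$ (i) The function $b$ is bounded, continuous and strictly positive on $[-1,1]$. (ii) The covariance function $\rho(t,s):=\operatorname{Cov}(X(0,0),X(t,s))$ of the random grain model $X$ satisfies $$\rho(t,s)\sim b(\operatorname{sgn}(s)\,t/w)\,w^{-(\alpha-1)/p}\quad\text{as }|t|+|s|\to\infty,$$ where $\operatorname{sgn}(s)=1$ for $s\ge0$ and $\operatorname{sgn}(s)=-1$ for $s<0$, and $\sim$ means that the ratio of the two sides tends to $1$.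
   Context: Notation: $\mathbb{R}_+=(0,\infty)$, $\operatorname{leb}$ is Lebesgue measure on $\mathbb{R}^2$, $\mathbf{1}(\cdot)$ is the indicator. Standing assumptions: $c_f>0$; $F$ is a probability distribution on $\mathbb{R}_+$ with a density $f$ such that $f(r)\sim c_f r^{-1-\alpha}$ as $r\to\infty$; $B\subset\mathbb{R}^2$ is a bounded Borel set with $\operatorname{leb}(B)>0$ whose boundary satisfies $\operatorname{leb}(\partial B)=0$. Random grain model: let $N(du,dv,dr)$ be a Poisson random measure on $\mathbb{R}^2\times\mathbb{R}_+$ with intensity $du\,dv\,F(dr)$ and $$X(t,s)=\int_{\mathbb{R}^2\times\mathbb{R}_+}\mathbf{1}\Big(\Big(\frac{t-u}{r^p},\frac{s-v}{r^{1-p}}\Big)\in B\Big)N(du,dv,dr),\quad (t,s)\in\mathbb{R}^2,$$ a stationary random field with finite variance. *)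

(* Defs.v *)
From HB Require Import structures.
From mathcomp Require Import all_boot all_order all_algebra.
From mathcomp Require Import all_classical all_reals all_analysis.
From mathcomp Require Import measurable_realfun.

Set Implicit Arguments.
Unset Strict Implicit.
Unset Printing Implicit Defensive.

Import Order.TTheory GRing.Theory Num.Theory.
Import numFieldNormedType.Exports.

Local Open Scope classical_set_scope.
Local Open Scope ring_scope.

Definition boundary {T : topologicalType} (A : set T) : set T :=
  closure A `\` interior A.

Definition leb2 (R : realType) :
    {measure set (measurableTypeR R * measurableTypeR R) -> \bar R} :=
  (@lebesgue_measure R \x @lebesgue_measure R)%E.

Definition has_density {R : realType} (F : probability (measurableTypeR R) R)
    (f : R -> R) : Prop :=
  [/\ measurable_fun [set: R] f, forall r, 0 <= f r &
      forall A : set (measurableTypeR R), measurable A ->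
        F A = (\int[lebesgue_measure]_(r in A) (f r)%:E)%E].

(* Mutual independence; taking [C i := setT] for some of the [i] gives the
   product rule for every subfamily. *)
Definition independent_RVs {d} {T : measurableType d} {R : realType}
    (P : probability T R) (n : nat) (X : 'I_n -> T -> \bar R) : Prop :=
  forall C : 'I_n -> set (\bar R), (forall i, measurable (C i)) ->
    P [set w | forall i, C i (X i w)] =
    (\prod_(i < n) P [set w | C i (X i w)])%E.

(* [N w A] is the random mass of [A]; measurability of [w |-> N w A] is part of
   [N] being a kernel. In [poisson_prob rate n U] the argument [n : nat] is unused
   by the library; the law at rate 0 is the Dirac mass at 0. *)
Definition poisson_random_measure {d} {T : measurableType d}
    {d'} {E : measurableType d'} {R : realType}
    (P : probability T R) (N : R.-ker T ~> E)
    (mu : {measure set E -> \bar R}) : Prop :=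
  [/\ forall A, measurable A -> (mu A < +oo)%E -> forall k : nat,
        P [set w | N w A = k%:R%:E] = poisson_prob (fine (mu A)) 0%N [set k],
      forall A, measurable A -> mu A = +oo%E -> P [set w | N w A = +oo%E] = 1%E
    & forall (n : nat) (A : 'I_n -> set E), (forall i, measurable (A i)) ->
        trivIset [set: 'I_n] A -> independent_RVs P (fun i w => N w (A i))].

(* The points [((u, v), r)] of R^2 x R_+ sit in [R * R * R]; as [F] is carried by
   ]0, +oo[, the complement of R^2 x R_+ is null for the intensity. *)
Definition grain_intensity {R : realType}
    (F : probability (measurableTypeR R) R) :
    {measure set (measurableTypeR R * measurableTypeR R * measurableTypeR R)
      -> \bar R} :=
  (leb2 R \x F)%E.

Definition grain_field {R : realType} {d} {T : measurableType d}
    (B : set (R * R)) (p : R)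
    (N : R.-ker T ~>
           (measurableTypeR R * measurableTypeR R * measurableTypeR R)%type)
    (t s : R) (w : T) : R :=
  Rintegral (N w) [set x | 0 < x.2]
    (fun x : R * R * R => \1_B ((t - x.1.1) / x.2 `^ p,
                                (s - x.1.2) / x.2 `^ (1 - p))).

(* A diverging integral would give the value 0 through [fine]; this is ruled out
   whenever the value is known to be positive. *)
Definition grain_b {R : realType} (B : set (R * R)) (p alpha c_f z : R) : R :=
  c_f * Rintegral (@lebesgue_measure R) `]0, +oo[
    (fun r : R =>
      fine (leb2 R (B `&`
        [set x + (z / r `^ p,
                  (1 - `|z| `^ (p^-1)) `^ (1 - p) / r `^ (1 - p)) | x in B]))
      * r `^ (- alpha)).

Definition grain_cov {R : realType} {d} {T : measurableType d}
    (P : probability T R) (B : set (R * R)) (p : R)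
    (N : R.-ker T ~>
           (measurableTypeR R * measurableTypeR R * measurableTypeR R)%type)
    (t s : R) : R :=
  fine (covariance P (grain_field B p N 0 0) (grain_field B p N t s)).

(* [Num.sg] is 0 at 0, hence not the convention wanted here. *)
Definition sgn {R : realType} (s : R) : R := if 0 <= s then 1 else - 1.

Definition scaling_w {R : realType} (p t s : R) : R :=
  (`|t| `^ (p^-1) + `|s| `^ ((1 - p)^-1)) `^ p.

(* The regime |t| + |s| -> oo in the plane. *)
Definition l1_infty (R : realType) : set_system (R * R) :=
  filter_from [set: R] (fun M => [set x | M < `|x.1| + `|x.2|]).
Arguments l1_infty R : clear implicits.

Global Instance l1_infty_proper (R : realType) : ProperFilter (l1_infty R).
Proof.
apply: filter_from_proper.
  apply: filter_from_filter; first by exists 0.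
  move=> a b _ _; exists (Num.max a b) => // x /=.
  by rewrite gt_max => /andP[].
move=> M _; exists (M + 1, M + 1) => /=.
apply: (lt_le_trans _ (lerD (ler_norm _) (normr_ge0 _))).
by rewrite addr0 ltrDl.
Qed.

(* Main.v *)
Require Import Defs.
From HB Require Import structures.
From mathcomp Require Import all_boot all_order all_algebra.
From mathcomp Require Import all_classical all_reals all_analysis.
From mathcomp Require Import measurable_realfun.
From mathcomp Require Import ring lra.

Set Implicit Arguments.
Unset Strict Implicit.
Unset Printing Implicit Defensive.

Import Order.TTheory GRing.Theory Num.Theory.
Import numFieldNormedType.Exports.

Local Open Scope classical_set_scope.
Local Open Scope ring_scope.

(** The field at [x] counts the Poisson points whose grain covers [x], so the
    covariance of the counts at [0] and [x] is the intensity of the set of grains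
    covering both points ([poisson_random_measure_covariance]).  Given its radius
    [r], such a grain has its centre in an affine copy of
    [B `&` (B + grain_shift p x r)], the factor of area being
    [r ^ p * r ^ (1 - p) = r]; integrating over the law of the radius,

      rho x = \int_0^oo r * overlap B (grain_shift p x r) * f r dr

    ([grain_intensity_covering], with [overlap B a] the area of [B `&` (B + a)]).

    As [B] is bounded, the overlap vanishes as soon as [r] is smaller than a fixed
    multiple of [gauge p x = |x.1| ^ (1 / p) + |x.2| ^ (1 / (1 - p))].  When the
    gauge is large, only large radii are therefore seen, where [r * f r] lies
    between [(1 - e) * c_f * r ^ - alpha] and [(1 + e) * c_f * r ^ - alpha].  The
    integrand above is thus squeezed pointwise between multiples of one function,
    and [rho x] lies within a factor [1 +- e] of [c_f * tail_integral B p alpha x],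
    where [tail_integral] is the integral with [r ^ - alpha] in place of [r * f r]
    ([covering_integral_sandwich]).  This limit integral is exactly homogeneous:
    substituting [gauge p x * r] for [r] reduces it to a point of gauge one, which
    gives [b (sgn x.2 * x.1 / w) * w ^ (- (alpha - 1) / p)] on the nose
    ([grain_b_scaling]).  Because the error is a fraction of the limit integral
    itself, the ratio tends to one without any uniformity in the direction of [x].

    Boundedness and continuity of [b] come from dominated convergence: the null
    boundary makes [overlap B] continuous ([overlap_cvg]), and all points of gauge
    at least one share the dominating function [V * r ^ - alpha] on a half-line
    [r >= 1 / K], integrable since [1 < alpha] ([tail_integrand_dominated]).
    Positivity holds because large radii give small shifts, whose overlap is close
    to the area of [B] ([tail_integral_gt0]). *)

(** * Moments of Poisson laws *)

Lemma poisson_prob_mass (R : realType) (m : R) :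
  (\sum_(k <oo) poisson_prob m 0%N [set k] = 1)%E.
Proof.
have <- : poisson_prob m 0%N [set: nat] = 1%E by exact: probability_setT.
rewrite (_ : [set: nat] = \bigcup_k [set k]); last first.
  by apply/seteqP; split=> // k _; exists k.
rewrite measure_semi_bigcup//.
by apply/trivIsetP => i j _ _ ij; apply/seteqP; split=> // k /= [-> /eqP]; rewrite (negbTE ij).
Qed.

Lemma poisson_prob_succ (R : realType) (m : R) (k : nat) : 0 <= m ->
  (k.+1%:R%:E * poisson_prob m 0%N [set k.+1] =
   m%:E * poisson_prob m 0%N [set k])%E.
Proof.
move=> m0; rewrite /poisson_prob; case: ltP => [mp|mn]; last first.
  have -> : m = 0 by apply/eqP; rewrite eq_le mn.
  by rewrite mul0e diracE memNset ?mule0.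
rewrite !esum_set1 ?lee_fin ?poisson_pmf_ge0// /poisson_pmf mp -!EFinM.
congr EFin; rewrite factS natrM exprS.
have k0 : (k`!%:R : R) != 0 by rewrite pnatr_eq0 -lt0n fact_gt0.
have k1 : (k.+1%:R : R) != 0 by rewrite pnatr_eq0.
move: k0 k1; move: (k`!%:R) (k.+1%:R) => a b a0 b0.
by field; rewrite a0 b0.
Qed.

(** Since [(k + 1) q (k + 1) = m q k] for the Poisson weights [q], summing
    against [k g k] amounts to summing against the shifted weight [m g (k + 1)]. *)
Lemma poisson_prob_shift (R : realType) (m : R) (g : nat -> R) : 0 <= m ->
  (forall k, 0 <= g k) ->
  (\sum_(k <oo) (k%:R * g k)%:E * poisson_prob m 0%N [set k] =
   m%:E * \sum_(k <oo) (g k.+1)%:E * poisson_prob m 0%N [set k])%E.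
Proof.
move=> m0 g0.
have ge0 k : (0 <= (k%:R * g k)%:E * poisson_prob m 0%N [set k])%E.
  by rewrite mule_ge0// lee_fin mulr_ge0.
rewrite nneseries_recl// mul0r mul0e add0e -nneseriesZl; last first.
  by move=> k _; rewrite mule_ge0// lee_fin.
rewrite -(nneseries_addn 1)//; apply: eq_eseriesr => k _.
rewrite addn1 mulrC EFinM -muleA poisson_prob_succ//.
by rewrite !muleA [(m%:E * _)%E]muleC.
Qed.

Lemma poisson_prob_mean (R : realType) (m : R) : 0 <= m ->
  (\sum_(k <oo) k%:R%:E * poisson_prob m 0%N [set k] = m%:E)%E.
Proof.
move=> m0; have := @poisson_prob_shift R m (fun=> 1) m0 (fun=> ler01).
under eq_eseriesr do rewrite mulr1.
move=> ->.
by under eq_eseriesr do rewrite mul1e; rewrite poisson_prob_mass mule1.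
Qed.

Lemma poisson_prob_moment2 (R : realType) (m : R) : 0 <= m ->
  (\sum_(k <oo) (k%:R ^+ 2)%:E * poisson_prob m 0%N [set k] = (m ^+ 2 + m)%:E)%E.
Proof.
move=> m0; have := @poisson_prob_shift R m (fun k => k%:R) m0 (fun k => ler0n _ _).
under eq_eseriesr do rewrite -expr2.
move=> ->.
have -> : (\sum_(k <oo) k.+1%:R%:E * poisson_prob m 0%N [set k] =
    \sum_(k <oo) (k%:R%:E * poisson_prob m 0%N [set k] + poisson_prob m 0%N [set k]))%E.
  apply: eq_eseriesr => k _.
  by rewrite -natr1 EFinD ge0_muleDl ?mul1e// lee_fin.
rewrite nneseriesD//; last first.
  by move=> k _; rewrite mule_ge0// lee_fin.
rewrite poisson_prob_mass poisson_prob_mean// -EFinD -EFinM; congr EFin.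
by ring.
Qed.

(** The law of [Z] has total mass one on the integers, so [Z] is integer-valued
    outside a null set, and an expectation reduces to a series. *)
Lemma integral_poisson_law d (T : measurableType d) (R : realType)
    (P : probability T R) (Z : T -> \bar R) (m : R) :
  measurable_fun [set: T] Z ->
  (forall k : nat, P [set w | Z w = k%:R%:E] = poisson_prob m 0%N [set k]) ->
  {ae P, forall w, exists k : nat, Z w = k%:R%:E} /\
  forall h : R -> R, measurable_fun [set: R] h -> (forall x, 0 <= h x) ->
   (\int[P]_w (h (fine (Z w)))%:E =
    \sum_(k <oo) (h k%:R)%:E * poisson_prob m 0%N [set k])%E.
Proof.
move=> mZ PZ.
pose D (k : nat) := [set w | Z w = k%:R%:E].
have mD k : measurable (D k).
  by have := mZ measurableT [set k%:R%:E] (emeasurable_set1 _); rewrite setTI.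
have tD : trivIset setT D.
  apply/trivIsetP => i j _ _ ij; apply/seteqP; split=> // w [] /=.
  by rewrite /D/= => -> [] /eqP; rewrite eqr_nat (negbTE ij).
have mU : measurable (\bigcup_k D k) by apply: bigcup_measurable => k _; exact: mD.
have PD : P (\bigcup_k D k) = 1%E.
  rewrite measure_semi_bigcup// -(poisson_prob_mass m).
  by apply: eq_eseriesr => k _; exact: PZ.
have N0 : P (~` (\bigcup_k D k)) = 0%E.
  by rewrite probability_setC// [X in (1 - X)%E]PD subee.
split.
  exists (~` (\bigcup_k D k)); split => //; first exact: measurableC.
  by move=> w /= nZ [k _ Zw]; apply: nZ; exists k.
move=> h mh h0.
have mhZ : measurable_fun [set: T] (fun w => (h (fine (Z w)))%:E).
  apply/measurable_EFinP; apply: measurableT_comp => //.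
  exact: measurableT_comp.
rewrite (@ge0_negligible_integral _ _ _ _ setT (~` (\bigcup_k D k)))//=; last 2 first.
- exact: measurableC.
- by move=> w _; rewrite lee_fin.
rewrite setDE setCK setTI ge0_integral_bigcup//; last 2 first.
- exact: measurable_funS mhZ.
- by move=> w _; rewrite lee_fin.
apply: eq_eseriesr => k _.
rewrite (eq_integral (fun=> (h k%:R)%:E)); last first.
  by move=> w; rewrite inE /D/= => ->.
by rewrite integral_cst//; congr (_ * _)%E; exact: PZ.
Qed.

(** * Second moments of a Poisson random measure *)

Section poisson_random_measure_covariance.
Context d (T : measurableType d) d' (E : measurableType d') (R : realType).
Variables (P : probability T R) (N : R.-ker T ~> E).
Variable mu : {measure set E -> \bar R}.
Hypothesis hN : poisson_random_measure P N mu.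
Implicit Types A B : set E.

Let count A w : R := fine (N w A).

Let count_ge0 A w : 0 <= count A w.
Proof. by rewrite fine_ge0. Qed.

Let measurable_count A : measurable A -> measurable_fun [set: T] (count A).
Proof. by move=> mA; apply: measurableT_comp => //; exact: measurable_kernel. Qed.

Let count_law A : measurable A -> (mu A < +oo)%E ->
  {ae P, forall w, exists k : nat, N w A = k%:R%:E} /\
  forall h : R -> R, measurable_fun [set: R] h -> (forall x, 0 <= h x) ->
   (\int[P]_w (h (count A w))%:E =
    \sum_(k <oo) (h k%:R)%:E * poisson_prob (fine (mu A)) 0%N [set k])%E.
Proof.
move=> mA A_fin; have [PN _ _] := hN.
apply: integral_poisson_law; first exact: measurable_kernel.
exact: PN.
Qed.

Let count_mean A : measurable A -> (mu A < +oo)%E ->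
  (\int[P]_w (count A w)%:E = (fine (mu A))%:E)%E.
Proof.
move=> mA A_fin; have [_ countE] := count_law mA A_fin.
rewrite -[RHS](poisson_prob_mean (fine_ge0 _))//.
have := countE Num.norm (@normr_measurable R setT) (@normr_ge0 R R).
under eq_integral do rewrite ger0_norm ?count_ge0//.
by under eq_eseriesr do rewrite ger0_norm//.
Qed.

Let count_moment2 A : measurable A -> (mu A < +oo)%E ->
  (\int[P]_w (count A w ^+ 2)%:E = (fine (mu A) ^+ 2 + fine (mu A))%:E)%E.
Proof.
move=> mA A_fin; have [_ countE] := count_law mA A_fin.
rewrite -[RHS](poisson_prob_moment2 (fine_ge0 _))//.
by apply: (countE (fun x => x ^+ 2)) => // x; exact: sqr_ge0.
Qed.

(* Off a null set both counts are finite, so that [fine] is additive on them. *)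
Let count_add A B : measurable A -> measurable B -> (mu A < +oo)%E ->
  (mu B < +oo)%E -> A `&` B = set0 ->
  {ae P, forall w, count (A `|` B) w = count A w + count B w}.
Proof.
move=> mA mB A_fin B_fin AB0.
have [+ _] := count_law mA A_fin; have [+ _] := count_law mB B_fin.
apply: filterS2 => w [k Bk] [j Aj].
rewrite /count measureU// Bk Aj.
by have -> : (N w A + N w B = j%:R%:E + k%:R%:E)%E by congr (_ + _)%E.
Qed.

(** Counts of disjoint sets are uncorrelated: the count of the union is their sum,
    and the Poisson variances already add up to its variance. *)
Let count_prod_disjoint A B : measurable A -> measurable B ->
  (mu A < +oo)%E -> (mu B < +oo)%E -> A `&` B = set0 ->
  (\int[P]_w (count A w * count B w)%:E = (fine (mu A) * fine (mu B))%:E)%E.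
Proof.
move=> mA mB A_fin B_fin AB0.
have mcA := measurable_count mA; have mcB := measurable_count mB.
have U_E : mu (A `|` B) = (mu A + mu B)%E by rewrite measureU.
have U_fin : (mu (A `|` B) < +oo)%E by rewrite U_E lte_add_pinfty.
have mU : measurable (A `|` B) by exact: measurableU.
have : (\int[P]_w (count (A `|` B) w ^+ 2)%:E =
    \int[P]_w (((count A w ^+ 2)%:E + (count A w * count B w)%:E) +
               ((count A w * count B w)%:E + (count B w ^+ 2)%:E)))%E.
  apply: ge0_ae_eq_integral => //.
  - apply/measurable_EFinP; apply: measurable_funX; exact: measurable_count.
  - do 2?[apply: emeasurable_funD];
      apply/measurable_EFinP; by [apply: measurable_funX|apply: measurable_funM].
  - by move=> w _; rewrite lee_fin sqr_ge0.
  - by move=> w _; rewrite !adde_ge0// lee_fin ?sqr_ge0// mulr_ge0.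
  - have := count_add mA mB A_fin B_fin AB0.
    by apply: filterS => w wE _; rewrite wE -!EFinD; congr EFin; ring.
rewrite !ge0_integralD//; last 9 first.
all: try by move=> w _; rewrite ?adde_ge0// lee_fin ?sqr_ge0// mulr_ge0.
all: try by [apply/measurable_EFinP; apply: measurable_funX |
   apply/measurable_EFinP; apply: measurable_funM|
   apply: emeasurable_funD;
      apply/measurable_EFinP; by [apply: measurable_funX|apply: measurable_funM]].
rewrite !count_moment2// U_E fineD ?ge0_fin_numE//.
have : (0 <= \int[P]_w (count A w * count B w)%:E)%E.
  by apply: integral_ge0 => w _; rewrite lee_fin mulr_ge0.
case: (\int[P]_w _)%E => //= x _; rewrite -!EFinD => -[xE].
by congr EFin; lra.
Qed.

Let count_prod A B : measurable A -> measurable B ->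
  (mu A < +oo)%E -> (mu B < +oo)%E ->
  (\int[P]_w (count A w * count B w)%:E =
   (fine (mu (A `&` B)) + fine (mu A) * fine (mu B))%:E)%E.
Proof.
move=> mA mB A_fin B_fin.
set I := A `&` B; set A' := A `\` B; set B' := B `\` A.
have mI : measurable I by exact: measurableI.
have mA' : measurable A' by exact: measurableD.
have mB' : measurable B' by exact: measurableD.
have I_fin : (mu I < +oo)%E.
  by apply: le_lt_trans A_fin; apply: le_measure; rewrite ?inE//; exact: subIsetl.
have A'_fin : (mu A' < +oo)%E.
  by apply: le_lt_trans A_fin; apply: le_measure; rewrite ?inE//; exact: subDsetl.
have B'_fin : (mu B' < +oo)%E.
  by apply: le_lt_trans B_fin; apply: le_measure; rewrite ?inE//; exact: subDsetl.
have IA : I `&` A' = set0 by apply/seteqP; split=> // x [[_ ?] []].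
have IB : I `&` B' = set0 by apply/seteqP; split=> // x [[? _] []].
have AI : A' `&` I = set0 by rewrite setIC.
have AB : A' `&` B' = set0 by apply/seteqP; split=> // x [[? _] []].
have AE : A = I `|` A' by rewrite setUIDK.
have BE : B = I `|` B' by rewrite /I setIC setUIDK.
have mcI := measurable_count mI; have mcA := measurable_count mA'.
have mcB := measurable_count mB'.
have -> : (\int[P]_w (count A w * count B w)%:E =
    \int[P]_w (((count I w ^+ 2)%:E + (count I w * count B' w)%:E) +
               ((count A' w * count I w)%:E + (count A' w * count B' w)%:E)))%E.
  apply: ge0_ae_eq_integral => //.
  - by apply/measurable_EFinP; apply: measurable_funM; exact: measurable_count.
  - do 2?[apply: emeasurable_funD];
      apply/measurable_EFinP; by [apply: measurable_funX|apply: measurable_funM].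
  - by move=> w _; rewrite lee_fin mulr_ge0.
  - by move=> w _; rewrite !adde_ge0// lee_fin ?sqr_ge0// mulr_ge0.
  - have := count_add mI mA' I_fin A'_fin IA.
    have := count_add mI mB' I_fin B'_fin IB.
    apply: filterS2 => w; rewrite -AE -BE => -> -> _.
    by rewrite -!EFinD; congr EFin; ring.
rewrite !ge0_integralD//; last 9 first.
all: try by move=> w _; rewrite ?adde_ge0// lee_fin ?sqr_ge0// mulr_ge0.
all: try by [apply/measurable_EFinP; apply: measurable_funX |
   apply/measurable_EFinP; apply: measurable_funM|
   apply: emeasurable_funD;
      apply/measurable_EFinP; by [apply: measurable_funX|apply: measurable_funM]].
rewrite count_moment2// !count_prod_disjoint// -!EFinD; congr EFin.
have -> : fine (mu A) = fine (mu I) + fine (mu A').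
  by rewrite AE measureU// fineD// ge0_fin_numE.
have -> : fine (mu B) = fine (mu I) + fine (mu B').
  by rewrite BE measureU// fineD// ge0_fin_numE.
by ring.
Qed.

(** Split [A] and [B] along [A `&` B]: only the common part is correlated with
    itself, and its variance is its intensity. *)
Lemma poisson_random_measure_covariance A B :
  measurable A -> measurable B -> (mu A < +oo)%E -> (mu B < +oo)%E ->
  covariance P (fun w => fine (N w A)) (fun w => fine (N w B)) =
  (fine (mu (A `&` B)))%:E.
Proof.
move=> mA mB A_fin B_fin.
have intY C : measurable C -> (mu C < +oo)%E -> count C \in Lfun P 1.
  move=> mC C_fin; apply/Lfun1_integrable/integrableP; split.
    by apply/measurable_EFinP; exact: measurable_count.
  under eq_integral do rewrite /= ger0_norm ?count_ge0//.
  by rewrite count_mean// ltry.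
rewrite covarianceE; [|exact: intY|exact: intY|].
  rewrite !unlock/= [X in (X - _ * _)%E]count_prod// !count_mean// -EFinM -EFinB.
  by rewrite addrK.
apply/Lfun1_integrable/integrableP; split.
  by apply/measurable_EFinP; apply: measurable_funM; exact: measurable_count.
under eq_integral do rewrite /= ger0_norm ?mulr_ge0 ?fine_ge0//.
by rewrite [ltLHS]count_prod// ltry.
Qed.

End poisson_random_measure_covariance.

(** * Planar Lebesgue measure *)

(** The product sigma-algebra contains the open sets, since an open set is the
    union of the countably many rational boxes that it contains. *)
Lemma open_measurable_plane (R : realType) (O : set (R * R)) : open O ->
  measurable (O : set (measurableTypeR R * measurableTypeR R)).
Proof.
move=> oO.
pose box (q : (rat * rat) * (rat * rat)) : set (R * R) :=
  `]ratr q.1.1, ratr q.1.2[%classic `*` `]ratr q.2.1, ratr q.2.2[%classic.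
pose F q : set (measurableTypeR R * measurableTypeR R) :=
  if `[< box q `<=` O >] then box q else set0.
have -> : O = \bigcup_q F q.
  apply/seteqP; split=> [x Ox|x [q _]]; last first.
    by rewrite /F; case: asboolP => // qO /qO.
  have /nbhs_ballP[e /= e0 xO] : nbhs x O by move: oO; rewrite openE; exact.
  have encl (y : R) : exists q : rat * rat,
      [/\ y - e < ratr q.1, ratr q.1 < y, y < ratr q.2 & ratr q.2 < y + e].
    have ye : y - e < y by rewrite ltrBlDr ltrDl.
    have ey : y < y + e by rewrite ltrDl.
    have [q] := rat_in_itvoo ye; have [r] := rat_in_itvoo ey.
    by rewrite !in_itv/= => /andP[? ?] /andP[? ?]; exists (q, r).
  have [q1 [q11 q12 q13 q14]] := encl x.1; have [q2 [q21 q22 q23 q24]] := encl x.2.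
  have qO : box (q1, q2) `<=` O.
    move=> y []; rewrite /= !in_itv/= => /andP[y1 y2] /andP[y3 y4]; apply: xO.
    by split; rewrite /ball/= ltr_norml; apply/andP; split; lra.
  exists (q1, q2) => //; rewrite /F asboolT//.
  by split; rewrite /= in_itv/= ?q12 ?q13 ?q22.
apply: countable_bigcupT_measurable => // q; rewrite /F; case: asboolP => // _.
by apply: measurableX; exact: measurable_itv.
Qed.

Lemma boundary_measurable_plane (R : realType) (B : set (R * R)) :
  measurable (boundary B : set (measurableTypeR R * measurableTypeR R)).
Proof.
apply: measurableD; last by apply: open_measurable_plane; exact: open_interior.
rewrite -[X in measurable X]setCK; apply: measurableC.
by apply: open_measurable_plane; apply: closed_openC; exact: closed_closure.
Qed.

Lemma measurable_affine (R : realType) (a c : R) :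
  measurable_fun [set: measurableTypeR R] ((fun x => a + c * x) : _ -> measurableTypeR R).
Proof. by apply: measurable_funD => //; exact: measurable_funM. Qed.

(** The rescaled image measure agrees with Lebesgue measure on intervals, which
    determine it. *)
Lemma lebesgue_measure_affine (R : realType) (a c : R) (A : set R) :
  c != 0 -> measurable (A : set (measurableTypeR R)) ->
  lebesgue_measure [set x | A (a + c * x)] =
    (`|c|^-1%:E * lebesgue_measure (A : set (measurableTypeR R)))%E.
Proof.
move=> c0 mA.
pose phi := (fun x => a + c * x) : measurableTypeR R -> measurableTypeR R.
have mphi : measurable_fun setT phi by exact: measurable_affine.
have c_ge0 : 0 <= `|c| by [].
pose nu := mscale (NngNum c_ge0) (pushforward (@lebesgue_measure R) phi).
have -> : lebesgue_measure A = nu mphi A.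
  rewrite /nu.
  apply: lebesgue_measure_unique => // _ [[u v]] _ <-.
  rewrite -[RHS]/(`|c|%:E * lebesgue_measure (phi @^-1` `]u, v]))%E.
  have [cp|cn|/eqP] := ltgtP 0 c; last by rewrite eq_sym (negbTE c0).
  - have -> : phi @^-1` `]u, v]%classic = `](u - a) / c, (v - a) / c]%classic.
      apply/seteqP; split=> x /=; rewrite !in_itv/= /phi.
        by rewrite ltr_pdivrMr// ler_pdivlMr// ltrBlDr lerBrDr ![_ + a]addrC ![c * _]mulrC.
      by rewrite ltr_pdivrMr// ler_pdivlMr// ltrBlDr lerBrDr ![_ + a]addrC ![c * _]mulrC.
    rewrite !lebesgue_measure_itv/= !lte_fin ltr_pM2r ?invr_gt0// ltrD2r.
    case: ifPn => uv; last by rewrite mule0.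
    by rewrite -!EFinB -EFinM gtr0_norm//; congr EFin; field; rewrite gt_eqF.
  - have -> : phi @^-1` `]u, v]%classic = `[(v - a) / c, (u - a) / c[%classic.
      apply/seteqP; split=> x /=; rewrite !in_itv/= /phi andbC.
        by rewrite ler_ndivrMr// ltr_ndivlMr// ltrBlDr lerBrDr ![_ + a]addrC ![c * _]mulrC.
      by rewrite ler_ndivrMr// ltr_ndivlMr// ltrBlDr lerBrDr ![_ + a]addrC ![c * _]mulrC.
    rewrite !lebesgue_measure_itv/= !lte_fin ltr_nM2r ?invr_lt0// ltrD2r.
    case: ifPn => uv; last by rewrite mule0.
    by rewrite -!EFinB -EFinM ltr0_norm//; congr EFin; field; rewrite lt_eqF.
rewrite /nu /mscale/= muleA -EFinM mulVf ?mul1e//.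
by rewrite normr_eq0.
Qed.

Lemma measurable_affine_plane (R : realType) (a c : R * R) :
  measurable_fun [set: measurableTypeR R * measurableTypeR R]
    ((fun x : R * R => (a.1 + c.1 * x.1, a.2 + c.2 * x.2)) :
       _ -> (measurableTypeR R * measurableTypeR R)%type).
Proof.
by apply: measurable_fun_pair; apply: (measurableT_comp (measurable_affine _ _)).
Qed.

Lemma leb2_prod (R : realType) (X Y : set (measurableTypeR R)) :
  measurable X -> measurable Y ->
  leb2 R (X `*` Y) = (lebesgue_measure X * lebesgue_measure Y)%E.
Proof. exact: product_measure1E. Qed.

Lemma leb2_affine (R : realType) (a c : R * R)
    (A : set (measurableTypeR R * measurableTypeR R)) :
  c.1 != 0 -> c.2 != 0 -> measurable A ->
  leb2 R [set x : R * R | A (a.1 + c.1 * x.1, a.2 + c.2 * x.2)] =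
    ((`|c.1| * `|c.2|)^-1%:E * leb2 R A)%E.
Proof.
move=> c10 c20 mA.
pose phi := (fun x : R * R => (a.1 + c.1 * x.1, a.2 + c.2 * x.2)) :
  measurableTypeR R * measurableTypeR R -> measurableTypeR R * measurableTypeR R.
have mphi : measurable_fun setT phi by exact: measurable_affine_plane.
have k_ge0 : 0 <= `|c.1| * `|c.2| by rewrite mulr_ge0.
pose nu := mscale (NngNum k_ge0) (pushforward (leb2 R) phi).
have k0 : `|c.1| * `|c.2| != 0 by rewrite mulf_neq0 ?normr_eq0.
have -> : leb2 R A = nu mphi A.
  rewrite /nu.
  apply: product_measure_unique => // X Y mX mY.
  rewrite -[LHS]/((`|c.1| * `|c.2|)%:E * leb2 R (phi @^-1` (X `*` Y)))%E.
  have -> : phi @^-1` (X `*` Y) =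
      [set x | X (a.1 + c.1 * x)] `*` [set x | Y (a.2 + c.2 * x)] by [].
  rewrite leb2_prod; last 2 first.
  - by rewrite -[X in measurable X]setTI; exact: measurable_affine.
  - by rewrite -[X in measurable X]setTI; exact: measurable_affine.
  have kE : `|c.1| * `|c.2| * (`|c.1|^-1 * `|c.2|^-1) = 1 by rewrite -invfM mulfV.
  have assoc (k i j : R) (x y : \bar R) :
    (k%:E * (i%:E * x * (j%:E * y)) = (k * (i * j))%:E * (x * y))%E.
    by rewrite 2!EFinM -!muleA (muleCA x).
  by rewrite !lebesgue_measure_affine// assoc kE mul1e.
rewrite /nu /mscale/= muleA -EFinM mulVf ?mul1e//.
Qed.

Lemma leb2_sigma_finite (R : realType) : sigma_finite setT (leb2 R).
Proof.
have /sigma_finiteP[F [FT Fnd Foo]] := sigma_finiteT (@lebesgue_measure R).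
exists (fun n => F n `*` F n) => [|n].
  rewrite -setXTT {1 2}FT predeqE => -[x y]; split.
    move=> [/= [n _ Fnx] [k _ Gky]]; exists (maxn n k) => //; split.
    - by move: x Fnx; exact/subsetPset/Fnd/leq_maxl.
    - by move: y Gky; exact/subsetPset/Fnd/leq_maxr.
  by move=> [n _ []/= ? ?]; split; exists n.
have [mF F_fin] := Foo n; split; first exact: measurableX.
by rewrite leb2_prod// lte_mul_pinfty// ge0_fin_numE.
Qed.

(** [leb2] bundled with its sigma-finiteness, as Fubini's theorem for
    [grain_intensity] requires. *)
Definition leb2_sfinite (R : realType) :
    {sigma_finite_measure set (measurableTypeR R * measurableTypeR R)%type -> \bar R} :=
  HB.pack_for {sigma_finite_measure set (measurableTypeR R * measurableTypeR R)%type -> \bar R}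
   (Measure.sort (leb2 R)) (Measure_isSigmaFinite.Build _ _ _ (leb2 R) (@leb2_sigma_finite R)).

(** * Overlap of a planar set with its translates *)

Definition overlap (R : realType) (B : set (R * R)) (a : R * R) : R :=
  fine (leb2 R (B `&` [set x | B (x - a)])).

Section overlap_theory.
Context (R : realType) (B : set (R * R)).
Hypothesis mB : measurable (B : set (measurableTypeR R * measurableTypeR R)).
Implicit Types a x : R * R.

Lemma translate_image a : [set x + a | x in B] = [set x | B (x - a)].
Proof.
apply/seteqP; split=> [_ [x Bx <-]|x Bx] /=; first by rewrite addrK.
by exists (x - a); rewrite ?subrK.
Qed.

Lemma leb2_translate a (A : set (measurableTypeR R * measurableTypeR R)) :
  measurable A -> leb2 R [set x : R * R | A (x - a)] = leb2 R A.
Proof.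
move=> mA; have := @leb2_affine R (- a) (1, 1) A (oner_neq0 _) (oner_neq0 _) mA.
rewrite /= normr1 mulr1 invr1 mul1e => <-; congr (leb2 R _).
by apply/seteqP; split=> -[x1 x2]; rewrite /= !mul1r ![- _ + _]addrC.
Qed.

Lemma measurable_translate a (A : set (measurableTypeR R * measurableTypeR R)) :
  measurable A ->
  measurable ([set x | A (x - a)] : set (measurableTypeR R * measurableTypeR R)).
Proof.
move=> mA; have := @measurable_affine_plane R (- a) (1, 1) measurableT A mA.
rewrite setTI; congr (measurable _).
by apply/seteqP; split=> -[x1 x2]; rewrite /= !mul1r ![- _ + _]addrC.
Qed.

Lemma overlap_ge0 a : 0 <= overlap B a.
Proof. exact: fine_ge0. Qed.

Hypothesis bB : bounded_set B.

Lemma bounded_setP : exists2 M, 0 < M & forall x, B x -> `|x| <= M.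
Proof. by have [M M0 BM] := pinfty_ex_gt0 bB; exists M. Qed.

Lemma leb2_lty : (leb2 R B < +oo)%E.
Proof.
have [M M0 BM] := bounded_setP.
apply: (@le_lt_trans _ _ (leb2 R (`[- M, M]%classic `*` `[- M, M]%classic))).
  apply: le_measure; rewrite ?inE//.
    by apply: measurableX; exact: measurable_itv.
  move=> x /BM; rewrite /Num.norm/= ge_max => /andP[x1 x2].
  by split; rewrite /= in_itv/= -ler_norml.
rewrite leb2_prod//; [|exact: measurable_itv..].
rewrite !lebesgue_measure_itv/=; case: ifPn => _; last by rewrite mule0 ltry.
by rewrite -!EFinB -EFinM ltry.
Qed.

Let mBI a : measurable (B `&` [set x | B (x - a)] :
  set (measurableTypeR R * measurableTypeR R)).
Proof. by apply: measurableI => //; exact: measurable_translate. Qed.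

Lemma overlapE a : (overlap B a)%:E = leb2 R (B `&` [set x | B (x - a)]).
Proof.
rewrite fineK// ge0_fin_numE//; apply: le_lt_trans leb2_lty.
by apply: le_measure; rewrite ?inE//; exact: subIsetl.
Qed.

Lemma overlap_le a : overlap B a <= fine (leb2 R B).
Proof.
rewrite -lee_fin overlapE fineK ?ge0_fin_numE ?leb2_lty//.
by apply: le_measure; rewrite ?inE//; exact: subIsetl.
Qed.

Lemma overlap0 : overlap B 0 = fine (leb2 R B).
Proof.
rewrite /overlap; congr (fine (leb2 R _)).
by apply/seteqP; split=> [x []//|x Bx]; split => //=; rewrite subr0.
Qed.

Lemma overlapN a : overlap B (- a) = overlap B a.
Proof.
rewrite /overlap -(leb2_translate a (mBI (- a))); congr (fine (leb2 R _)).
by apply/seteqP; split=> x /=; rewrite opprK subrK => -[].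
Qed.

(** If [x] and [x - a] both lie in [B] then [a] is at most the diameter of [B]. *)
Lemma overlap_eq0 : exists2 M, 0 < M &
  forall a, M < `|a.1| \/ M < `|a.2| -> overlap B a = 0.
Proof.
have [M M0 BM] := bounded_setP; exists (M + M); first by rewrite addr_gt0.
move=> a aM; rewrite /overlap (_ : _ `&` _ = set0) ?measure0//.
apply/seteqP; split=> // x [/BM xM /BM xaM].
have le_aM : `|a| <= M + M.
  by rewrite -[a](subKr x) (le_trans (ler_normB _ _))// lerD.
move: le_aM; rewrite {1}/Num.norm/= ge_max => /andP[a1 a2].
by case: aM => /lt_geF; rewrite ?a1 ?a2.
Qed.

Hypothesis B_bdry : leb2 R (boundary B) = 0%E.

(** The indicator of the translate of [B] by [u n] converges to that of the
    translate by [a] off the translated boundary, which is a null set. *)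
Lemma overlap_cvg (u : nat -> R * R) a : u @ \oo --> a ->
  overlap B (u n) @[n --> \oo] --> overlap B a.
Proof.
move=> ua.
pose f c x : \bar R := (\1_(B `&` [set x | B (x - c)]) x)%:E.
have mf c : measurable_fun [set: measurableTypeR R * measurableTypeR R] (f c).
  by apply/measurable_EFinP; apply: measurable_indic; exact: mBI.
have intf c : (\int[leb2 R]_x f c x = (overlap B c)%:E)%E.
  by rewrite overlapE integral_indic// setIT.
apply: fine_cvg; rewrite -intf.
under eq_fun do rewrite -overlapE -intf.
have bound : {ae leb2 R, forall x n, setT x -> (`|f (u n) x| <= (\1_B x)%:E)%E}.
  apply: aeW => x n _; rewrite /f/= lee_fin ger0_norm// !indicE.
  have [|] := boolP (x \in B `&` _) => //; rewrite inE => -[Bx _].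
  by rewrite mem_set.
have int1B : (leb2 R).-integrable setT (EFin \o \1_B).
  apply/integrableP; split; first by apply/measurable_EFinP; exact: measurable_indic.
  under eq_integral do rewrite /= ger0_norm//.
  by rewrite integral_indic// setIT leb2_lty.
suff pointwise : {ae leb2 R, forall x, setT x -> f (u n) x @[n --> \oo] --> f a x}.
  by have [] := @dominated_convergence _ _ _ (leb2 R) setT measurableT
    (fun n => f (u n)) (f a) (EFin \o \1_B) (fun n => mf (u n)) (mf a)
    pointwise int1B bound.
exists [set x | boundary B (x - a)]; split.
- by apply: measurable_translate; exact: boundary_measurable_plane.
- by rewrite leb2_translate//; exact: boundary_measurable_plane.
move=> x /= nx; apply: contrapT => nbd; apply: nx => _.
apply: cvg_near_cst; rewrite /f.
have xua : x - u n @[n --> \oo] --> x - a by apply: cvgB => //; exact: cvg_cst.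
have [Bxa|nBxa] := pselect (interior B (x - a)).
  near=> n; have Bn : B (x - u n) by near: n; exact: (xua B Bxa).
  have Bxa' := interior_subset Bxa.
  rewrite !indicE (_ : (x \in B `&` [set x | B (x - u n)]) = (x \in B `&` [set x | B (x - a)]))//.
  by apply: asbool_equiv_eq; split=> -[? _].
have nclB : (~` closure B) (x - a) by move=> clB; apply: nbd; split.
have ncl : nbhs (x - a) (~` closure B).
  by have := closed_openC (@closed_closure _ B); rewrite openE; apply.
near=> n; have nBn : (~` closure B) (x - u n) by near: n; exact: (xua _ ncl).
 rewrite !indicE.
have no c : (~` closure B) (x - c) -> (x \in B `&` [set x | B (x - c)]) = false.
  move=> nc; apply/negbTE/negP; rewrite inE => -[_ Bxc]; apply: nc.
  exact: (@subset_closure _ B (x - c)).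
by rewrite !no.
Unshelve. all: by end_near.
Qed.

Hypothesis B_pos : (0 < leb2 R B)%E.

Lemma overlap0_gt0 : 0 < overlap B 0.
Proof. by rewrite overlap0 fine_gt0// B_pos leb2_lty. Qed.

End overlap_theory.

(** * Integrals over the half-line *)

Lemma continuous_powR_gt0 (R : realType) (a x : R) : 0 < x ->
  {for x, continuous (fun y => y `^ a)}.
Proof.
move=> x0; apply: differentiable_continuous; apply/derivable1_diffP.
by apply: derivable_powR; rewrite in_itv/= andbT.
Qed.

Lemma continuous_norm_powR (R : realType) (a : R) : 0 < a ->
  continuous (fun x : R => `|x| `^ a).
Proof.
move=> a0 x; have [->|x0] := eqVneq x 0; last first.
  apply: (@continuous_comp _ _ _ (fun y : R => `|y|) (fun y => y `^ a)).
    exact: norm_continuous.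
  by apply: continuous_powR_gt0; rewrite normr_gt0.
rewrite /continuous_at/= normr0 powR0 ?gt_eqF//; apply/cvgrPdist_lt => e e0.
near=> y; rewrite sub0r normrN ger0_norm ?powR_ge0//.
have -> : e = (e `^ a^-1) `^ a by rewrite -powRrM mulVf ?powRr1 ?gt_eqF// ltW.
apply: gt0_ltr_powR => //; rewrite ?nnegrE ?powR_ge0//.
near: y; have e'0 : 0 < e `^ a^-1 by rewrite powR_gt0.
have := @norm_continuous _ _ (0 : R); rewrite /continuous_at normr0.
move/cvgrPdist_lt => /(_ _ e'0).
by apply: filterS => y; rewrite sub0r normrN normr_id.
Unshelve. all: by end_near.
Qed.

Lemma integral_powR_tail_lty (R : realType) (alpha a : R) : 1 < alpha -> 0 < a ->
  (\int[lebesgue_measure]_(r in `[a, +oo[) (r `^ (- alpha))%:E < +oo)%E.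
Proof.
move=> alpha1 a0; have k0 : 1 - alpha != 0 by rewrite subr_eq0 lt_eqF.
have alpha0 : 0 < alpha - 1 by rewrite subr_gt0.
pose G (x : R) := (1 - alpha)^-1 * x `^ (1 - alpha).
have dpow x : 0 < x -> derivable (fun x => x `^ (1 - alpha)) x 1.
  by move=> x0; apply: derivable_powR; rewrite in_itv/= andbT.
have dG x : 0 < x -> derivable G x 1 by move=> x0; apply: derivableM => //; exact: dpow.
rewrite (@ge0_continuous_FTC2y _ _ G _ 0); first by rewrite -EFinB ltry.
- by move=> x _; exact: powR_ge0.
- apply/continuous_within_itvcyP; split.
    move=> x; rewrite in_itv/= andbT => ax; apply: continuous_powR_gt0.
    exact: lt_trans ax.
  by apply: cvg_at_right_filter; exact: continuous_powR_gt0.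
- rewrite -(mulr0 (1 - alpha)^-1); apply: cvgM; first exact: cvg_cst.
  apply/cvgrPdist_lt => e e0; near=> x.
  have x0 : 0 < x by near: x; exact: nbhs_pinfty_gt.
  rewrite sub0r normrN ger0_norm ?powR_ge0//.
  rewrite -opprB powRN invf_plt ?posrE ?powR_gt0//.
  have -> : e^-1 = (e^-1 `^ (alpha - 1)^-1) `^ (alpha - 1).
    by rewrite -powRrM mulVf ?powRr1 ?gt_eqF// invr_ge0 ltW.
  have xe : e^-1 `^ (alpha - 1)^-1 < x by near: x; exact: nbhs_pinfty_gt.
  by apply: gt0_ltr_powR => //; rewrite nnegrE ?powR_ge0// ltW.
- by move=> x ax; apply: dG; exact: lt_trans ax.
- apply: cvg_at_right_filter; apply: differentiable_continuous.
  by apply/derivable1_diffP; exact: dG.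
- move=> x; rewrite in_itv/= andbT => ax; have x0 : 0 < x by exact: lt_trans ax.
  rewrite derive1E deriveM//; last exact: dpow.
  rewrite derive_cst scaler0 addr0 -derive1E powR_derive1; last first.
    by rewrite in_itv/= andbT.
  rewrite /GRing.scale/= mulrA mulVf// mul1r; congr (_ `^ _).
  by rewrite addrAC subrr sub0r.
Unshelve. all: by end_near.
Qed.

Lemma integral_halfline_scale (R : realType) (h : R -> \bar R) (c : R) : 0 < c ->
  measurable_fun [set: R] h -> (forall r, 0 <= h r)%E ->
  (\int[lebesgue_measure]_(r in `]0%R, +oo[) h r =
   c%:E * \int[lebesgue_measure]_(r in `]0%R, +oo[) h (c * r)%R)%E.
Proof.
move=> c0 mh h0.
pose phi := (fun x => 0 + c * x) : measurableTypeR R -> measurableTypeR R.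
have mphi : measurable_fun setT phi by exact: measurable_affine.
have c_ge0 : 0 <= c by exact: ltW.
have D : phi @^-1` `]0, +oo[%classic = `]0, +oo[%classic.
  by apply/seteqP; split=> x; rewrite /phi/= !in_itv/= !andbT add0r pmulr_rgt0.
have := @ge0_integral_pushforward _ _ _ _ _ phi mphi lebesgue_measure
  `]0%R, +oo[%classic h.
rewrite D => pushE.
have -> : (\int[lebesgue_measure]_(r in `]0%R, +oo[) h (c * r)%R =
    \int[lebesgue_measure]_(r in `]0%R, +oo[) (h \o phi) r)%E.
  by apply: eq_integral => x _; rewrite /phi/= add0r.
rewrite -pushE//; last exact: measurable_funTS.
rewrite -(@ge0_integral_mscale _ _ _ _ _ _ (NngNum c_ge0))//; last exact: measurable_funTS.
apply: eq_measure_integral => A mA _.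
rewrite -[RHS]/(c%:E * lebesgue_measure (phi @^-1` A))%E.
rewrite /phi lebesgue_measure_affine ?gt_eqF// muleA -EFinM gtr0_norm//.
by rewrite mulfV ?mul1e ?gt_eqF.
Qed.

(** * Anisotropic scaling and the limiting covariance *)

(** Homogeneous of degree one for the anisotropic dilations of [grain_shift]; the
    normalising factor [w] of the covariance is its power [p]. *)
Definition gauge (R : realType) (p : R) (x : R * R) : R :=
  `|x.1| `^ p^-1 + `|x.2| `^ (1 - p)^-1.

Definition grain_shift (R : realType) (p : R) (x : R * R) (r : R) : R * R :=
  (x.1 / r `^ p, x.2 / r `^ (1 - p)).

(** The covariance at [x] when [r * f r] is replaced by its equivalent
    [c_f * r ^ - alpha], up to the factor [c_f]. *)
Definition tail_integral (R : realType) (B : set (R * R)) (p alpha : R)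
    (x : R * R) : \bar R :=
  (\int[lebesgue_measure]_(r in `]0%R, +oo[)
    (overlap B (grain_shift p x r) * r `^ (- alpha))%:E)%E.

Section tail_integral_theory.
Context (R : realType) (p alpha : R).
Hypotheses (hp : 0 < p < 1) (halpha : 1 < alpha).
Implicit Types x : R * R.

Let p0 : 0 < p. Proof. by case/andP: hp. Qed.
Let q0 : 0 < 1 - p. Proof. by rewrite subr_gt0; case/andP: hp. Qed.

Lemma powR_divK (q a c : R) : 0 < q -> 0 < c ->
  `|a / c `^ q| `^ q^-1 = `|a| `^ q^-1 / c.
Proof.
move=> q_gt0 c0; rewrite normrM powRM// normfV [`|_ `^ _|]ger0_norm ?powR_ge0//.
by rewrite -powRN -powRrM mulNr mulfV ?gt_eqF// powR_inv1// ltW.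
Qed.

Lemma gauge_shift x r : 0 < r -> gauge p (grain_shift p x r) = gauge p x / r.
Proof. by move=> r0; rewrite /gauge !powR_divK// mulrDl. Qed.

Lemma grain_shift_mul x c r : 0 <= c -> 0 <= r ->
  grain_shift p x (c * r) = grain_shift p (grain_shift p x c) r.
Proof. by move=> c0 r0; rewrite /grain_shift/= !powRM// !invfM !mulrA. Qed.

Lemma measurable_grain_shift x :
  measurable_fun [set: R] (grain_shift p x : R -> (measurableTypeR R * measurableTypeR R)%type).
Proof.
rewrite (_ : grain_shift p x = fun r => (x.1 * r `^ (- p), x.2 * r `^ (- (1 - p)))).
  by apply: measurable_fun_pair; apply: measurable_funM.
by apply/funext => r; rewrite !powRN.
Qed.

Lemma cvg_grain_shift (u : nat -> R * R) x r : u @ \oo --> x ->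
  grain_shift p (u n) r @[n --> \oo] --> grain_shift p x r.
Proof.
move=> ux.
have u1 : (u n).1 @[n --> \oo] --> x.1 by exact: cvg_comp ux cvg_fst.
have u2 : (u n).2 @[n --> \oo] --> x.2 by exact: cvg_comp ux cvg_snd.
exact: (cvg_pair (cvgM u1 (cvg_cst _)) (cvgM u2 (cvg_cst _))).
Qed.

Variable B : set (R * R).
Hypothesis mB : measurable (B : set (measurableTypeR R * measurableTypeR R)).

Lemma measurable_overlap_shift x :
  measurable_fun [set: R] (fun r => overlap B (grain_shift p x r)).
Proof.
pose tr (y : (R * R) * R) : R * R := y.1 - grain_shift p x y.2.
have mtr : measurable_fun
    [set: (measurableTypeR R * measurableTypeR R * measurableTypeR R)%type]
    (tr : _ -> (measurableTypeR R * measurableTypeR R)%type).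
  apply: measurable_fun_pair => /=; apply: measurable_funB.
  - exact: measurableT_comp.
  - apply: (@measurableT_comp _ _ _ _ _ _ (fst \o grain_shift p x)) => //.
    exact: measurableT_comp (measurable_grain_shift x).
  - exact: measurableT_comp.
  - apply: (@measurableT_comp _ _ _ _ _ _ (snd \o grain_shift p x)) => //.
    exact: measurableT_comp (measurable_grain_shift x).
pose S : set (measurableTypeR R * measurableTypeR R * measurableTypeR R) :=
  (fst @^-1` B) `&` (tr @^-1` B).
have mS : measurable S.
  apply: measurableI.
    by rewrite -[X in measurable X]setTI; apply: measurable_fst.
  by rewrite -[X in measurable X]setTI; apply: mtr.
have := measurable_fun_ysection (leb2_sfinite R) mS.
have -> : (fun r => overlap B (grain_shift p x r)) = fine \o (leb2_sfinite R \o ysection S).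
  by apply/funext => r; rewrite /= ysectionE.
by move=> mleb; apply: measurableT_comp.
Qed.

Lemma measurable_tail_integrand x :
  measurable_fun [set: R] (fun r => overlap B (grain_shift p x r) * r `^ (- alpha)).
Proof. by apply: measurable_funM => //; exact: measurable_overlap_shift. Qed.

Lemma tail_integral_ge0 x : (0 <= tail_integral B p alpha x)%E.
Proof.
by apply: integral_ge0 => r _; rewrite lee_fin mulr_ge0 ?powR_ge0 ?overlap_ge0.
Qed.

(** The change of variable [c * r] for [r]. *)
Lemma tail_integral_scale x c : 0 < c ->
  tail_integral B p alpha x =
  ((c `^ (1 - alpha))%:E * tail_integral B p alpha (grain_shift p x c))%E.
Proof.
move=> c0; rewrite /tail_integral (integral_halfline_scale c0); last 2 first.
- by apply/measurable_EFinP; exact: measurable_tail_integrand.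
- by move=> r; rewrite lee_fin mulr_ge0 ?powR_ge0 ?overlap_ge0.
have -> : c `^ (1 - alpha) = c * c `^ (- alpha).
  by rewrite powRD ?powRr1 ?ltW// (gt_eqF c0) implybT.
rewrite EFinM -muleA.
congr (_ * _)%E; rewrite -ge0_integralZl//; last 3 first.
- by apply/measurable_EFinP; apply: measurable_funTS; exact: measurable_tail_integrand.
- by move=> r _; rewrite lee_fin mulr_ge0 ?powR_ge0 ?overlap_ge0.
- by rewrite lee_fin powR_ge0.
apply: eq_integral => r; rewrite inE/= in_itv/= andbT => r0.
rewrite -EFinM grain_shift_mul ?ltW// powRM ?ltW//; congr EFin.
by rewrite mulrCA mulrA.
Qed.

(** Translates by [a] and by [- a] overlap [B] equally; the factor [sgn] in the
    asymptotics picks one of the two points [x] and [- x]. *)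
Lemma tail_integralN x : tail_integral B p alpha (- x) = tail_integral B p alpha x.
Proof.
apply: eq_integral => r _; rewrite (_ : grain_shift p (- x) r = - grain_shift p x r).
  by rewrite overlapN.
by rewrite /grain_shift/= !mulNr.
Qed.

Hypothesis bB : bounded_set B.

(** Shifts of large gauge move [B] off itself: small radii do not contribute. *)
Lemma overlap_gauge_eq0 : exists2 K, 0 < K &
  forall a, K < gauge p a -> overlap B a = 0.
Proof.
have [M M0 aM] := overlap_eq0 bB.
exists (M `^ p^-1 + M `^ (1 - p)^-1); first by rewrite addr_gt0// powR_gt0.
move=> a Ka; apply: aM; apply: contrapT => /not_orP[/negP + /negP].
rewrite -!leNgt => a1 a2; move: Ka; apply/negP; rewrite -leNgt.
have M_ge0 := ltW M0; have p_ge0 := ltW p0; have q_ge0 := ltW q0.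
by apply: lerD; apply: ge0_ler_powR; rewrite ?nnegrE ?invr_ge0.
Qed.

(** All the integrands with gauge at least one are dominated by one multiple of
    [r ^ - alpha] on a half-line away from the origin. *)
Lemma tail_integrand_dominated : exists2 G : R -> R,
  lebesgue_measure.-integrable `]0%R, +oo[ (EFin \o G) &
  forall x r, 1 <= gauge p x -> 0 < r ->
    overlap B (grain_shift p x r) * r `^ (- alpha) <= G r.
Proof.
have [K K0 aK] := overlap_gauge_eq0.
have V0 : 0 <= fine (leb2 R B) by exact: fine_ge0.
pose H (r : R) := \1_(`[K^-1, +oo[%classic : set R) r * r `^ (- alpha).
have mH : measurable_fun [set: R] H.
  by apply: measurable_funM => //; apply: measurable_indic; exact: measurable_itv.
have H0 r : 0 <= H r by rewrite mulr_ge0 ?powR_ge0.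
exists (fun r => fine (leb2 R B) * H r).
  apply/integrableP; split.
    by apply/measurable_EFinP; apply: measurable_funTS; apply: measurable_funM.
  under eq_integral do rewrite /= (ger0_norm (mulr_ge0 V0 (H0 _))) EFinM.
  rewrite ge0_integralZl//; last 2 first.
  - by apply/measurable_EFinP; exact: measurable_funTS.
  - by move=> r _; rewrite lee_fin.
  rewrite lte_mul_pinfty//.
  have Kinv : 0 < K^-1 by rewrite invr_gt0.
  apply: (le_lt_trans _ (integral_powR_tail_lty halpha Kinv)).
  rewrite [leLHS]integral_mkcond [leRHS]integral_mkcond.
  apply: ge0_le_integral => //.
  - by move=> r _; rewrite patchE; case: ifPn => // _; rewrite lee_fin.
  - apply/(measurable_restrictT _ _).1 => //; apply/measurable_EFinP.
    exact: measurable_funTS.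
  - apply/(measurable_restrictT _ _).1 => //; apply/measurable_EFinP.
    exact: measurable_funTS.
  - move=> r _; rewrite !patchE /H indicE.
    rewrite !mem_setE !in_itv/= !andbT -[point]/(0%:E : \bar R).
    case: (K^-1 <= r)%R; case: (0 < r)%R; rewrite ?mul1r ?mul0r//; try by rewrite lee_fin powR_ge0.
move=> x r x1 r0; rewrite mulrA ler_wpM2r ?powR_ge0// indicE.
have [_|] := boolP (r \in _); first by rewrite mulr1 overlap_le.
rewrite notin_setE/= in_itv/= andbT => /negP; rewrite -ltNge => rK.
rewrite mulr0 aK// gauge_shift// ltr_pdivlMr// (lt_le_trans _ x1)//.
by rewrite mulrC -ltr_pdivlMr// div1r.
Qed.

Lemma tail_integral_bounded : exists M : R, forall x, 1 <= gauge p x ->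
  (tail_integral B p alpha x <= M%:E)%E.
Proof.
have [G intG le_G] := tail_integrand_dominated.
exists (fine (\int[lebesgue_measure]_(r in `]0%R, +oo[) (G r)%:E)%E) => x x1.
rewrite fineK; last exact: (integrable_fin_num _ intG).
apply: ge0_le_integral => //.
- by move=> r _; rewrite lee_fin mulr_ge0 ?powR_ge0 ?overlap_ge0.
- by apply/measurable_EFinP; apply: measurable_funTS; exact: measurable_tail_integrand.
- exact: measurable_int intG.
- by move=> r; rewrite /= in_itv/= andbT => r0; rewrite lee_fin le_G.
Qed.

Lemma tail_integral_lty x : 1 <= gauge p x -> (tail_integral B p alpha x < +oo)%E.
Proof.
move=> x1; have [M /(_ x x1) le_M] := tail_integral_bounded.
exact: le_lt_trans le_M (ltry _).
Qed.

Hypothesis B_bdry : leb2 R (boundary B) = 0%E.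

Lemma tail_integral_cvg (u : nat -> R * R) x :
  (forall n, 1 <= gauge p (u n)) -> 1 <= gauge p x -> u @ \oo --> x ->
  fine (tail_integral B p alpha (u n)) @[n --> \oo] -->
  fine (tail_integral B p alpha x).
Proof.
move=> u1 x1 ux; have [G intG le_G] := tail_integrand_dominated.
pose f y (r : R) := (overlap B (grain_shift p y r) * r `^ (- alpha))%:E.
have mf y : measurable_fun (`]0, +oo[%classic : set R) (f y).
  by apply/measurable_EFinP; apply: measurable_funTS; exact: measurable_tail_integrand.
apply: fine_cvg; rewrite fineK; last first.
  by rewrite ge0_fin_numE ?tail_integral_ge0 ?tail_integral_lty.
have pointwise : {ae lebesgue_measure, forall r, (`]0%R, +oo[%classic : set R) r ->
    f (u n) r @[n --> \oo] --> f x r}.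
  apply: aeW => r _; apply: cvg_EFin; first by apply: nearW.
  apply: cvgM; last exact: cvg_cst.
  by apply: overlap_cvg => //; exact: cvg_grain_shift.
have bound : {ae lebesgue_measure, forall r n, (`]0%R, +oo[%classic : set R) r ->
    (`|f (u n) r| <= (G r)%:E)%E}.
  apply: aeW => r n; rewrite /= in_itv/= andbT => r0; rewrite lee_fin.
  by rewrite ger0_norm ?mulr_ge0 ?powR_ge0 ?overlap_ge0// le_G.
by have [] := @dominated_convergence _ _ _ lebesgue_measure `]0%R, +oo[%classic
  (measurable_itv _) (fun n => f (u n)) (f x) (EFin \o G) (fun n => mf (u n)) (mf x)
  pointwise intG bound.
Qed.

Hypothesis B_pos : (0 < leb2 R B)%E.

(** Large radii give small shifts, whose overlap is close to the area of [B]. *)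
Lemma tail_integral_gt0 x : (0 < tail_integral B p alpha x)%E.
Proof.
have V0 := overlap0_gt0 mB bB B_pos.
pose c := overlap B 0 / 2.
have c0 : 0 < c by rewrite divr_gt0.
have [r1 r10 cr1] : exists2 r1 : R, 0 < r1 &
    forall r, r1 <= r -> c <= overlap B (grain_shift p x r).
  apply: contrapT => nex.
  have small (n : nat) : exists r, n.+1%:R <= r /\ overlap B (grain_shift p x r) < c.
    apply: contrapT => nr; apply: nex; exists n.+1%:R => // r nr'.
    by rewrite leNgt; apply/negP => ?; apply: nr; exists r.
  (* radii tending to infinity along which the overlap stays below [c] *)
  have [rn /all_and2[rn_ge rn_lt]] := choice small.
  have rn_oo (q : R) : 0 < q -> (rn n `^ q)^-1 @[n --> \oo] --> (0 : R).
    move=> q_gt0; apply/cvgrPdist_lt => e e0; near=> n.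
    have rn0 : 0 < rn n by exact: lt_le_trans (rn_ge n).
    rewrite sub0r normrN ger0_norm ?invr_ge0 ?powR_ge0//.
    rewrite invf_plt ?posrE ?powR_gt0//.
    have -> : e^-1 = (e^-1 `^ q^-1) `^ q.
      by rewrite -powRrM mulVf ?powRr1 ?gt_eqF// invr_ge0 ltW.
    have e_lt : e^-1 `^ q^-1 < rn n.
      apply: lt_le_trans (rn_ge n); near: n.
      exists (Num.trunc (e^-1 `^ q^-1)) => // n /= ne.
      by rewrite (lt_le_trans (truncnS_gt _))// ler_nat.
    by apply: gt0_ltr_powR => //; rewrite nnegrE ?powR_ge0// ltW.
  have shift0 : grain_shift p x (rn n) @[n --> \oo] --> (0 : R * R).
    rewrite (_ : 0 = (x.1 * 0, x.2 * 0)); last by rewrite !mulr0.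
    exact: (cvg_pair (cvgM (cvg_cst _) (rn_oo _ p0)) (cvgM (cvg_cst _) (rn_oo _ q0))).
  have := overlap_cvg mB bB B_bdry shift0.
  move/cvgrPdist_lt => /(_ c c0)[n _ /(_ n (leqnn n))].
  rewrite /= ltr_distlC => /andP[+ _]; apply/negP; rewrite -leNgt.
  rewrite (le_trans (ltW (rn_lt n)))// /c; lra.
pose m := c * (r1 + 1) `^ (- alpha).
have m0 : 0 < m by rewrite mulr_gt0// powR_gt0// addr_gt0.
apply: (@lt_le_trans _ _ (\int[lebesgue_measure]_(r in `[r1, (r1 + 1)%R]) m%:E)%E).
  rewrite integral_cst//= lebesgue_measure_itv/= lte_fin ltrDl ltr01.
  by rewrite -EFinB -EFinM lte_fin mulr_gt0// addrAC subrr add0r.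
apply: (@le_trans _ _ (\int[lebesgue_measure]_(r in `[r1, (r1 + 1)%R])
    (overlap B (grain_shift p x r) * r `^ (- alpha))%:E)%E).
  apply: ge0_le_integral => //.
  - by move=> r _; rewrite lee_fin ltW.
  - by apply/measurable_EFinP; apply: measurable_funTS; exact: measurable_tail_integrand.
  - move=> r; rewrite /= in_itv/= => /andP[r1r rr1]; rewrite lee_fin /m.
    have r0 : 0 < r by exact: lt_le_trans r1r.
    apply: ler_pM; rewrite ?powR_ge0 ?(ltW c0) ?cr1// !powRN lef_pV2 ?posrE ?powR_gt0 ?addr_gt0//.
    have alpha_ge0 : 0 <= alpha by exact: ltW (lt_trans ltr01 halpha).
    by apply: ge0_ler_powR; rewrite ?nnegrE ?addr_ge0// ltW.
apply: (@ge0_subset_integral _ _ _ lebesgue_measure `[r1, r1 + 1]%classic `]0, +oo[%classic) => //.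
- by apply/measurable_EFinP; apply: measurable_funTS; exact: measurable_tail_integrand.
- by move=> r _; rewrite lee_fin mulr_ge0 ?powR_ge0 ?overlap_ge0.
- move=> r; rewrite /= !in_itv/= andbT => /andP[r1r _]; exact: lt_le_trans r1r.
Unshelve. all: by end_near.
Qed.

End tail_integral_theory.

(** * Intensity of the grains covering two points *)

(** The density agrees almost everywhere with the Radon-Nikodym derivative. *)
Lemma integral_density (R : realType) (F : probability (measurableTypeR R) R)
    (f : R -> R) (D : set R) (h : R -> \bar R) : has_density F f ->
  measurable (D : set (measurableTypeR R)) -> measurable_fun [set: R] h ->
  (forall r, 0 <= h r)%E ->
  (\int[F]_(r in D) h r = \int[lebesgue_measure]_(r in D) (h r * (f r)%:E))%E.
Proof.
move=> [mf f0 FE] mD mh h0.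
have F_dom : F `<< (@lebesgue_measure R).
  apply/null_content_dominatesP => A mA A0.
  by rewrite FE// null_set_integral//; apply/measurable_EFinP; exact: measurable_funTS.
rewrite -(Radon_Nikodym_SigmaFinite.change_of_variables F_dom)//; last first.
  exact: measurable_funTS.
have mg := measurable_int _ (Radon_Nikodym_SigmaFinite.f_integrable F_dom).
apply: ge0_ae_eq_integral => //.
- by apply: emeasurable_funM; apply: measurable_funTS.
- apply: emeasurable_funM; first exact: measurable_funTS.
  by apply/measurable_EFinP; exact: measurable_funTS.
- by move=> r _; rewrite mule_ge0// Radon_Nikodym_SigmaFinite.f_ge0.
- by move=> r _; rewrite mule_ge0// lee_fin.
apply: ae_eqe_mul2l.
apply: (@ae_eq_subset _ _ _ _ _ setT) => //.
apply: integral_ae_eq => //.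
- exact: Radon_Nikodym_SigmaFinite.f_integrable.
- exact/measurable_EFinP.
- by move=> A _ mA; rewrite -Radon_Nikodym_SigmaFinite.f_integral//; exact: FE.
Qed.

Definition covering_grains (R : realType) (B : set (R * R)) (p : R) (x : R * R) :
    set (R * R * R) :=
  [set y | 0 < y.2 /\ B (grain_shift p (x - y.1) y.2)].

Section covering_grains_theory.
Context (R : realType) (p : R) (B : set (R * R)).
Hypothesis mB : measurable (B : set (measurableTypeR R * measurableTypeR R)).

Let mark : set (measurableTypeR R * measurableTypeR R * measurableTypeR R) :=
  [set y | 0 < y.2].

Let measurable_mark : measurable mark.
Proof.
rewrite (_ : mark = snd @^-1` `]0%R, +oo[%classic); last first.
  by apply/seteqP; split=> y; rewrite /mark/= in_itv/= andbT.
rewrite -[X in measurable X]setTI; exact: measurable_snd.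
Qed.

Let measurable_grain_map (x : R * R) : measurable_fun
  [set: (measurableTypeR R * measurableTypeR R * measurableTypeR R)%type]
  ((fun y : R * R * R => grain_shift p (x - y.1) y.2) :
     _ -> (measurableTypeR R * measurableTypeR R)%type).
Proof.
rewrite (_ : (fun y : R * R * R => _) = (fun y : R * R * R =>
   ((x.1 - y.1.1) * y.2 `^ (- p), (x.2 - y.1.2) * y.2 `^ (- (1 - p))))); last first.
  by apply/funext => y; rewrite !powRN.
have mfst : measurable_fun
    [set: (measurableTypeR R * measurableTypeR R * measurableTypeR R)%type]
    (fun y : R * R * R => y.1) by exact: measurable_fst.
have msnd : measurable_fun
    [set: (measurableTypeR R * measurableTypeR R * measurableTypeR R)%type]
    (fun y : R * R * R => y.2) by exact: measurable_snd.
apply: measurable_fun_pair; apply: measurable_funM.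
- by apply: measurable_funB => //; exact: measurableT_comp.
- exact: (measurableT_comp (measurable_powR _)).
- by apply: measurable_funB => //; exact: measurableT_comp.
- exact: (measurableT_comp (measurable_powR _)).
Qed.

Lemma measurable_covering_grains (x : R * R) :
  measurable (covering_grains B p x :
    set (measurableTypeR R * measurableTypeR R * measurableTypeR R)).
Proof.
apply: measurableI => //; rewrite -[X in measurable X]setTI.
exact: measurable_grain_map.
Qed.

Lemma grain_fieldE d (T : measurableType d) (N : R.-ker T ~>
    (measurableTypeR R * measurableTypeR R * measurableTypeR R)%type) (x : R * R) w :
  grain_field B p N x.1 x.2 w = fine (N w (covering_grains B p x)).
Proof.
pose C : set (measurableTypeR R * measurableTypeR R * measurableTypeR R) :=
  [set y | B (grain_shift p (x - y.1) y.2)].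
have mC : measurable C.
  by rewrite -[X in measurable X]setTI; exact: measurable_grain_map.
rewrite /grain_field /Rintegral; congr fine.
transitivity (\int[N w]_(y in mark) (\1_C y)%:E)%E; first by [].
by rewrite integral_indic// setIC.
Qed.

(** For a fixed radius [r], the centres of the grains covering both points form
    an affine image, by coordinate factors [r ^ p] and [r ^ (1 - p)], of the
    intersection of [B] with a translate; hence the Jacobian [r]. *)
Lemma leb2_covering_section (x y : R * R) (r : R) : 0 < r ->
  leb2 R (ysection (covering_grains B p x `&` covering_grains B p y) r) =
  (r%:E * leb2 R (B `&` [set z | B (z - grain_shift p (x - y) r)%R]))%E.
Proof.
move=> r0; set A := B `&` _.
have mA : measurable (A : set (measurableTypeR R * measurableTypeR R)).
  by apply: measurableI => //; exact: measurable_translate.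
have rp0 q : (- r `^ q)^-1 != 0 by rewrite invr_eq0 oppr_eq0 gt_eqF ?powR_gt0.
have := @leb2_affine R (grain_shift p x r) ((- r `^ p)^-1, (- r `^ (1 - p))^-1) A
  (rp0 _) (rp0 _) mA.
rewrite /= !normfV !normrN !ger0_norm ?powR_ge0// -invfM invrK.
rewrite -powRD ?(gt_eqF r0) ?implybT// addrCA subrr addr0 powRr1 ?(ltW r0)// => <-.
congr (leb2 R _); rewrite ysectionE.
have shiftE (z u : R * R) : grain_shift p (z - u) r =
    ((grain_shift p z r).1 + (- r `^ p)^-1 * u.1,
     (grain_shift p z r).2 + (- r `^ (1 - p))^-1 * u.2).
  by rewrite /grain_shift/= !invrN !mulNr !mulrBl ![_^-1 * _]mulrC.
have shiftBE (u : R * R) : grain_shift p (x - u) r - grain_shift p (x - y) r =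
    grain_shift p (y - u) r.
  by rewrite /grain_shift; congr (_, _); rewrite /= -mulrBl; congr (_ / _); ring.
apply/seteqP; split=> u; rewrite /A/= -shiftE shiftBE.
  by move=> [[_ ?] [_ ?]].
by move=> [? ?].
Qed.

(** Fubini's theorem, with the radius as outer variable. *)
Lemma grain_intensity_covering (F : probability (measurableTypeR R) R) (f : R -> R)
    (x y : R * R) : bounded_set B -> has_density F f ->
  grain_intensity F (covering_grains B p x `&` covering_grains B p y) =
  (\int[lebesgue_measure]_(r in `]0%R, +oo[)
     (r * overlap B (grain_shift p (x - y)%R r) * f r)%:E)%E.
Proof.
move=> bB hf; set A := _ `&` _.
have mA : measurable (A : set (measurableTypeR R * measurableTypeR R * measurableTypeR R)).
  by apply: measurableI; exact: measurable_covering_grains.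
have -> : grain_intensity F A = (leb2_sfinite R \x^ F)%E A.
  transitivity ((leb2_sfinite R \x F)%E A) => //.
  apply: product_measure_unique => // X Y mX mY; exact: product_measure2E.
rewrite /product_measure2 (_ : setT = [set` `]-oo, 0%R]] `|` [set` `]0%R, +oo[]); last first.
  by apply/seteqP; split=> // r _; rewrite /= !in_itv/= andbT; case: (leP r 0); [left|right].
pose h r : \bar R := leb2 R (ysection A r).
have mh : measurable_fun [set: R] h by exact: (measurable_fun_ysection (leb2_sfinite R) mA).
rewrite ge0_integral_setU//; last 2 first.
- exact: measurable_funTS.
- apply/disj_setPS => r; rewrite /= !in_itv/= andbT => -[r0].
  by rewrite ltNge r0.
rewrite [X in (X + _)%E]integral0_eq ?add0e; last first.
  move=> r; rewrite /= in_itv/= => r0; rewrite (_ : ysection A r = set0) ?measure0//.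
  apply/seteqP; split=> // u; rewrite ysectionE => -[[/=]].
  by rewrite ltNge r0.
rewrite -[LHS]/(\int[F]_(r in `]0%R, +oo[) h r)%E (integral_density hf)//.
apply: eq_integral => r; rewrite inE/= in_itv/= andbT => r0.
by rewrite /h leb2_covering_section// -overlapE// -!EFinM.
Qed.

End covering_grains_theory.

(** * Asymptotics of the covariance *)

Section covariance_asymptotics.
Context (R : realType) (p alpha c_f : R).
Hypotheses (hp : 0 < p < 1) (halpha : 1 < alpha) (hc : 0 < c_f).
Variables (F : probability (measurableTypeR R) R) (f : R -> R).
Hypothesis hf : has_density F f.
Hypothesis hftail : f r / (c_f * r `^ (- 1 - alpha)) @[r --> +oo] --> (1 : R).
Variable B : set (R * R).
Hypothesis mB : measurable (B : set (measurableTypeR R * measurableTypeR R)).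
Hypothesis bB : bounded_set B.
Implicit Types x : R * R.

Let p0 : 0 < p. Proof. by case/andP: hp. Qed.
Let q0 : 0 < 1 - p. Proof. by rewrite subr_gt0; case/andP: hp. Qed.
Let f0 r : 0 <= f r. Proof. by have [_ ->] := hf. Qed.
Let mf : measurable_fun [set: R] f. Proof. by have [] := hf. Qed.

Lemma density_tail e : 0 < e -> exists2 r0 : R, 0 < r0 & forall r, r0 <= r ->
  `|r * f r - c_f * r `^ (- alpha)| <= e * (c_f * r `^ (- alpha)).
Proof.
move=> e0; move/cvgrPdist_lt : hftail => /(_ e e0).
case=> m [_ mf_lt]; exists (Num.max m 0 + 1).
  by rewrite ltr_wpDl// le_max lexx orbT.
move=> r mr; have m'r : Num.max m 0 < r by rewrite (lt_le_trans _ mr)// ltrDl.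
have r0 : 0 < r by rewrite (le_lt_trans _ m'r)// le_max lexx orbT.
have mr' : m < r by rewrite (le_lt_trans _ m'r)// le_max lexx.
have := ltW (mf_lt r mr').
set q := f r / _ => q_le.
have pw : r `^ (- alpha) = r * r `^ (- 1 - alpha).
  rewrite -{2}[r]powRr1 ?ltW// -powRD ?(gt_eqF r0) ?implybT//.
  by congr (_ `^ _); ring.
have -> : r * f r - c_f * r `^ (- alpha) = - ((1 - q) * (c_f * r `^ (- alpha))).
  rewrite pw /q; field; rewrite (gt_eqF hc)/=.
  by rewrite gt_eqF ?powR_gt0.
rewrite normrN normrM [X in _ * X]ger0_norm ?mulr_ge0 ?powR_ge0 ?(ltW hc)//.
by rewrite ler_wpM2r// mulr_ge0 ?powR_ge0 ?(ltW hc).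
Qed.

Let halfline : set R := `]0, +oo[%classic.

Definition covering_integrand x (r : R) : R := r * overlap B (grain_shift p x r) * f r.

Lemma measurable_covering_integrand x :
  measurable_fun [set: R] (covering_integrand x).
Proof.
apply: measurable_funM => //; apply: measurable_funM => //.
exact: measurable_overlap_shift.
Qed.

(** A finite area times the mean radius: beyond [r0] the tail of [f] makes the
    radius integrable because [1 < alpha], and below [r0] it is bounded. *)
Lemma covering_grains_lty x :
  (grain_intensity F (covering_grains B p x) < +oo)%E.
Proof.
rewrite -[covering_grains B p x]setIid (@grain_intensity_covering _ p B mB F f)//.
have [r0 r00 tail] := density_tail ltr01.
pose V := fine (leb2 R B); have V0 : 0 <= V by exact: fine_ge0.
rewrite (_ : `]0%R, +oo[%classic = [set` `]0%R, r0]] `|` [set` `]r0, +oo[]); last first.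
  apply/seteqP; split=> r; rewrite /= !in_itv/= !andbT.
    by move=> ->; case: (leP r r0); [left|right].
  by move=> [/andP[]//|]; exact: lt_trans.
have int0 D : (forall r, D r -> 0 < r) -> forall r, D r ->
    (0 <= (r * overlap B (grain_shift p (x - x)%R r) * f r)%:E)%E.
  by move=> D0 r /D0 r_gt0; rewrite lee_fin !mulr_ge0 ?overlap_ge0// ltW.
have le_V r : 0 < r ->
    r * overlap B (grain_shift p (x - x)%R r) * f r <= V * (r * f r).
  move=> r_gt0; rewrite mulrAC [leRHS]mulrC ler_wpM2l ?overlap_le//.
  by rewrite mulr_ge0// ltW.
rewrite ge0_integral_setU//; last 3 first.
- by apply/measurable_EFinP; apply: measurable_funTS; exact: measurable_covering_integrand.
- apply: int0 => r [] /=; rewrite in_itv/=; first by move=> /andP[].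
  by rewrite andbT; exact: lt_trans.
- apply/disj_setPS => r; rewrite /= !in_itv/= andbT => -[/andP[_]].
  by rewrite ltNge => ->.
apply: lte_add_pinfty.
  apply: (@le_lt_trans _ _ ((V * r0)%:E * F `]0%R, r0]%classic)%E); last first.
    by rewrite lte_mul_pinfty ?lee_fin ?mulr_ge0 ?(ltW r00)// ltey_eq fin_num_measure.
  have [_ _ ->//] := hf.
  rewrite -ge0_integralZl//; last 3 first.
  - by apply/measurable_EFinP; exact: measurable_funTS.
  - by move=> r _; rewrite lee_fin.
  - by rewrite lee_fin mulr_ge0// ltW.
  apply: ge0_le_integral => //.
  - by apply: int0 => r /=; rewrite in_itv/= => /andP[].
  - by apply/measurable_EFinP; apply: measurable_funTS; exact: measurable_covering_integrand.
  - by apply/measurable_EFinP; apply: measurable_funTS; apply: measurable_funM.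
  - move=> r; rewrite /= in_itv/= => /andP[r_gt0 rr0]; rewrite -EFinM lee_fin.
    by rewrite (le_trans (le_V r r_gt0))// -mulrA ler_wpM2l// ler_wpM2r.
apply: (@le_lt_trans _ _ ((V * (2 * c_f))%:E *
    \int[lebesgue_measure]_(r in `[r0, +oo[) (r `^ (- alpha))%:E)%E); last first.
  rewrite lte_mul_pinfty ?lee_fin ?mulr_ge0 ?(ltW hc)//.
  exact: integral_powR_tail_lty.
rewrite -ge0_integralZl//; last 3 first.
- by apply/measurable_EFinP; exact: measurable_funTS.
- by move=> r _; rewrite lee_fin powR_ge0.
- by rewrite lee_fin !mulr_ge0// ltW.
apply: (@le_trans _ _ (\int[lebesgue_measure]_(r in `]r0, +oo[)
   ((V * (2 * c_f))%:E * (r `^ (- alpha))%:E)%E)%E); last first.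
  apply: ge0_subset_integral => //.
  - by apply/measurable_EFinP; apply: measurable_funTS; apply: measurable_funM.
  - by move=> r _; rewrite lee_fin !mulr_ge0 ?powR_ge0// ltW.
  - by move=> r; rewrite /= !in_itv/= !andbT; exact: ltW.
apply: ge0_le_integral => //.
- by apply: int0 => r /=; rewrite in_itv/= andbT; exact: lt_trans.
- by apply/measurable_EFinP; apply: measurable_funTS; exact: measurable_covering_integrand.
- by apply/measurable_EFinP; apply: measurable_funTS; apply: measurable_funM.
- move=> r; rewrite /= in_itv/= andbT => r0r; rewrite -EFinM lee_fin.
  rewrite (le_trans (le_V r (lt_trans r00 r0r)))// -mulrA ler_wpM2l//.
  have := tail r (ltW r0r); rewrite ler_norml => /andP[_].
  by rewrite mul1r lerBlDr => /le_trans; apply; rewrite -mulrA mulr_natl mulr2n.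
Qed.

(** Only radii above a fixed multiple of the gauge of [x] contribute, and there the
    density is uniformly close to its power-law equivalent. *)
Lemma covering_integral_sandwich e : 0 < e <= 1 -> exists L : R,
  forall x, L < gauge p x ->
  ((((1 - e) * c_f)%:E * tail_integral B p alpha x <=
    \int[lebesgue_measure]_(r in `]0%R, +oo[) (covering_integrand x r)%:E) /\
   (\int[lebesgue_measure]_(r in `]0%R, +oo[) (covering_integrand x r)%:E <=
    ((1 + e) * c_f)%:E * tail_integral B p alpha x))%E.
Proof.
move=> /andP[e0 e1].
have [K K0 aK] := overlap_gauge_eq0 hp bB.
have [r0 r00 tail] := density_tail e0.
exists (K * r0) => x xL.
pose T r := overlap B (grain_shift p x r) * r `^ (- alpha).
have T0 r : 0 <= T r by rewrite mulr_ge0 ?powR_ge0 ?overlap_ge0.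
have mT : measurable_fun [set: R] T by exact: measurable_tail_integrand.
have close r : 0 < r -> (1 - e) * c_f * T r <= covering_integrand x r /\
                        covering_integrand x r <= (1 + e) * c_f * T r.
  move=> r_gt0; rewrite /covering_integrand /T.
  have [Kr|Kr] := ltP (K * r) (gauge p x).
    by rewrite aK ?gauge_shift ?ltr_pdivlMr// !(mul0r, mulr0).
  have r0r : r0 <= r by rewrite -(ler_pM2l K0) (le_trans (ltW xL)).
  have := tail r r0r; rewrite ler_distl => /andP[lo up].
  set o := overlap _ _; have o0 : 0 <= o by exact: overlap_ge0.
  have -> : r * o * f r = o * (r * f r) by ring.
  split.
    have -> : (1 - e) * c_f * (o * r `^ (- alpha)) =
        o * (c_f * r `^ (- alpha) - e * (c_f * r `^ (- alpha))) by ring.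
    exact: ler_wpM2l.
  have -> : (1 + e) * c_f * (o * r `^ (- alpha)) =
      o * (c_f * r `^ (- alpha) + e * (c_f * r `^ (- alpha))) by ring.
  exact: ler_wpM2l.
have lo0 : 0 <= (1 - e) * c_f by rewrite mulr_ge0 ?subr_ge0// ltW.
have up0 : 0 <= (1 + e) * c_f by rewrite mulr_ge0 ?addr_ge0// ltW.
have mS : measurable_fun [set: R] (covering_integrand x).
  exact: measurable_covering_integrand.
have mkT k : measurable_fun halfline (fun r => (k * T r)%:E).
  by apply/measurable_EFinP; apply: measurable_funTS; apply: measurable_funM.
have S0 r : halfline r -> (0 <= (covering_integrand x r)%:E)%E.
  rewrite /halfline/= in_itv/= andbT => r_gt0.
  by rewrite lee_fin (le_trans _ (close r r_gt0).1)// mulr_ge0.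
have mhalf : measurable (halfline : set (measurableTypeR R)) by exact: measurable_itv.
have tailE k : 0 <= k -> (k%:E * tail_integral B p alpha x =
    \int[lebesgue_measure]_(r in halfline) (k * T r)%:E)%E.
  move=> k0; rewrite /tail_integral -ge0_integralZl//.
  - by apply/measurable_EFinP; exact: measurable_funTS.
  - by move=> r _; rewrite lee_fin T0.
rewrite !tailE//; split; apply: ge0_le_integral => //.
- by move=> r _; rewrite lee_fin mulr_ge0.
- exact: mkT.
- by apply/measurable_EFinP; exact: measurable_funTS.
- by move=> r; rewrite /halfline/= in_itv/= andbT => /close[? _]; rewrite lee_fin.
- by apply/measurable_EFinP; exact: measurable_funTS.
- exact: mkT.
- by move=> r; rewrite /halfline/= in_itv/= andbT => /close[_ ?]; rewrite lee_fin.
Qed.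

Lemma powR_le1 (q a : R) : 0 <= q -> 0 <= a <= 1 -> a `^ q <= 1.
Proof.
move=> q_ge0 /andP[a0 a1]; have <- : 1 `^ q = 1 :> R by rewrite powR1.
by apply: ge0_ler_powR; rewrite ?nnegrE.
Qed.

(** The point of gauge one with first coordinate [z], continued to all [z] so that
    the gauge stays at least one. *)
Definition unit_point (z : R) : R * R := (z, `|1 - `|z| `^ p^-1| `^ (1 - p)).

Lemma gauge_unit_point z : 1 <= gauge p (unit_point z).
Proof.
rewrite /gauge/= [`|_ `^ _|]ger0_norm ?powR_ge0// -powRrM mulfV ?gt_eqF// powRr1//.
have := ler_norm (1 - `|z| `^ p^-1); lra.
Qed.

Lemma grain_bE z : -1 <= z <= 1 ->
  grain_b B p alpha c_f z = c_f * fine (tail_integral B p alpha (unit_point z)).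
Proof.
move=> z1; have -> : unit_point z = (z, (1 - `|z| `^ p^-1) `^ (1 - p)).
  congr (_, _ `^ _); rewrite ger0_norm// subr_ge0.
  by rewrite powR_le1 ?invr_ge0 ?(ltW p0)// normr_ge0/= ler_norml.
apply: (congr1 (fun J => c_f * fine J)); apply: eq_integral => r _.
by rewrite translate_image.
Qed.

Lemma continuous_unit_point : continuous unit_point.
Proof.
move=> z.
have cont1 : y @[y --> z] --> z by exact: cvg_id.
have cont2 : `|1 - `|y| `^ p^-1| `^ (1 - p) @[y --> z] --> (unit_point z).2.
  apply: (@continuous_comp _ _ _ (fun z => 1 - `|z| `^ p^-1) (fun y => `|y| `^ (1 - p))).
    apply: cvgB; first exact: cvg_cst.
    by apply: continuous_norm_powR; rewrite invr_gt0.
  exact: continuous_norm_powR.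
exact: (cvg_pair cont1 cont2).
Qed.

(** A bound on the gauge bounds both coordinates. *)
Lemma gauge_unbounded (L : R) : \forall x \near l1_infty R, L < gauge p x.
Proof.
exists (Num.max L 0 `^ p + Num.max L 0 `^ (1 - p)) => // x /= xM.
rewrite ltNge; apply/negP => xL; move: xM; apply/negP; rewrite -leNgt.
have L0 : gauge p x <= Num.max L 0 by rewrite le_max xL.
have bnd q (a : R) : 0 < q -> `|a| `^ q^-1 <= gauge p x -> `|a| <= Num.max L 0 `^ q.
  move=> q_gt0 ax; have -> : `|a| = (`|a| `^ q^-1) `^ q.
    by rewrite -powRrM mulVf ?gt_eqF// powRr1.
  have M0 : 0 <= Num.max L 0 by rewrite le_max lexx orbT.
  apply: ge0_ler_powR; rewrite ?nnegrE ?powR_ge0 ?(ltW q_gt0)//.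
  exact: le_trans ax L0.
by apply: lerD; apply: bnd => //; rewrite /gauge ?lerDl ?lerDr powR_ge0.
Qed.

Lemma scaling_wE x : scaling_w p x.1 x.2 = gauge p x `^ p.
Proof. by []. Qed.

(** Rescaling the radius by the gauge of [x] turns [x] into plus or minus the
    point of gauge one with first coordinate [sgn x.2 * x.1 / w]. *)
Lemma unit_point_shift x l z : 0 < l -> gauge p x = l ->
  z = sgn x.2 * x.1 / l `^ p ->
  -1 <= z <= 1 /\
  (unit_point z = grain_shift p x l \/ unit_point z = - grain_shift p x l).
Proof.
move=> l0 xl zdef.
have sgn1 : `|sgn x.2| = 1 :> R.
  by rewrite /sgn; case: ifP => _; rewrite ?normrN normr1.
have zE : `|z| `^ p^-1 = `|x.1| `^ p^-1 / l.
  by rewrite -powR_divK// zdef -mulrA normrM sgn1 mul1r.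
have sum1 : `|x.1| `^ p^-1 / l + `|x.2 / l `^ (1 - p)| `^ (1 - p)^-1 = 1.
  by rewrite powR_divK// -mulrDl -[X in X / _]/(gauge p x) xl mulfV// gt_eqF.
have abs_root (q a : R) : 0 < q -> (`|a| `^ q^-1) `^ q = `|a|.
  by move=> q_gt0; rewrite -powRrM mulVf ?powRr1// gt_eqF.
split.
  rewrite -ler_norml -(abs_root p)// powR_le1 ?(ltW p0)// powR_ge0/= zE.
  by rewrite -[leRHS]sum1 lerDl powR_ge0.
have -> : unit_point z = (z, `|x.2| / l `^ (1 - p)).
  have oneE : 1 - `|z| `^ p^-1 = `|x.2 / l `^ (1 - p)| `^ (1 - p)^-1.
    by rewrite zE -[X in X - _]sum1 addrAC subrr add0r.
  rewrite /unit_point oneE; apply: (congr1 (pair z)).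
  rewrite ger0_norm ?powR_ge0// abs_root//.
  by rewrite normrM normfV [`|l `^ _|]ger0_norm ?powR_ge0.
rewrite zdef /sgn; case: ifPn => [x2|]; first by left; rewrite mul1r ger0_norm.
rewrite -ltNge => x2; right.
by rewrite ltr0_norm// mulN1r !mulNr.
Qed.

Lemma grain_b_scaling x : 0 < gauge p x ->
  grain_b B p alpha c_f (sgn x.2 * x.1 / scaling_w p x.1 x.2) *
    scaling_w p x.1 x.2 `^ (- ((alpha - 1) / p)) =
  c_f * fine (tail_integral B p alpha x).
Proof.
move=> g0; rewrite scaling_wE; have gN0 := lt0r_neq0 g0.
have [z1 unitE] := @unit_point_shift x _ _ g0 erefl erefl.
have unit_shift : tail_integral B p alpha
      (unit_point (sgn x.2 * x.1 / gauge p x `^ p)) =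
    tail_integral B p alpha (grain_shift p x (gauge p x)).
  by case: unitE => ->; rewrite ?tail_integralN.
have shift_fin : tail_integral B p alpha (grain_shift p x (gauge p x)) \is a fin_num.
  rewrite ge0_fin_numE; last exact: tail_integral_ge0.
  apply: (tail_integral_lty hp halpha mB bB).
  by rewrite (gauge_shift hp _ g0) (mulfV gN0).
have fineE : fine (tail_integral B p alpha x) = gauge p x `^ (1 - alpha) *
    fine (tail_integral B p alpha (grain_shift p x (gauge p x))).
  by rewrite [LHS](congr1 fine (tail_integral_scale p alpha mB x g0)) fineM.
rewrite (grain_bE z1) unit_shift -mulrA; apply: (congr1 (fun y => c_f * y)).
apply: etrans (esym fineE); rewrite mulrC; apply: (congr1 (fun y => y * _)).
rewrite -powRrM; apply: (congr1 (powR _)).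
by rewrite mulrN mulrCA (mulfV (lt0r_neq0 p0)) mulr1 opprB.
Qed.

End covariance_asymptotics.

(** * The asymptotics of the covariance field *)

Theorem theorem3p1 (R : realType) (alpha p c_f : R)
    (halpha : 1 < alpha < 2) (hp : 0 < p < 1) (hc : 0 < c_f)
    (F : probability (measurableTypeR R) R) (f : R -> R)
    (hF : F `]0, +oo[%classic = 1%E) (hf : has_density F f)
    (hftail : f r / (c_f * r `^ (- 1 - alpha)) @[r --> +oo] --> (1 : R))
    (B : set (R * R))
    (hBmeas : measurable (B : set (measurableTypeR R * measurableTypeR R)))
    (hBbnd : bounded_set B) (hBpos : (0 < leb2 R B)%E)
    (hBbdry : leb2 R (boundary B) = 0%E)
    (d : measure_display) (T : measurableType d) (P : probability T R)
    (N : R.-ker T ~>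
           (measurableTypeR R * measurableTypeR R * measurableTypeR R)%type)
    (hN : poisson_random_measure P N (grain_intensity F)) :
  let b := grain_b B p alpha c_f in
  let rho := grain_cov P B p N in
  let w := scaling_w p in
  [/\ [bounded b z | z in `[-1, 1]],
      {within `[-1, 1], continuous b}
    & forall z, -1 <= z <= 1 -> 0 < b z]
  /\
  rho x.1 x.2 /
    (b (sgn x.2 * x.1 / w x.1 x.2) * w x.1 x.2 `^ (- ((alpha - 1) / p)))
    @[x --> l1_infty R] --> (1 : R).
Proof.
move=> b rho w; have [alpha1 _] := andP halpha.
have tail_fin z : tail_integral B p alpha (unit_point p z) \is a fin_num.
  by rewrite ge0_fin_numE ?tail_integral_ge0// tail_integral_lty// gauge_unit_point.
have bE z : -1 <= z <= 1 -> b z = c_f * fine (tail_integral B p alpha (unit_point p z)).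
  exact: grain_bE.
have b_gt0 z : -1 <= z <= 1 -> 0 < b z.
  move=> z1; rewrite bE// mulr_gt0// fine_gt0// tail_integral_gt0//.
  by rewrite tail_integral_lty// gauge_unit_point.
split; first split => //.
- have [M bM] := tail_integral_bounded hp alpha1 hBmeas hBbnd.
  exists (c_f * M); split; first exact: num_real.
  move=> M' /ltW MM' z; rewrite /= in_itv/= => z1; apply: le_trans MM'.
  rewrite gtr0_norm ?b_gt0// bE// ler_pM2l// -lee_fin fineK//.
  by apply: bM; exact: gauge_unit_point.
- pose b' z := c_f * fine (tail_integral B p alpha (unit_point p z)).
  (* [b'] extends [b] to a continuous function on the line *)
  apply: (@subspace_eq_continuous _ _ _ (b' : subspace `[-1, 1] -> R)).
    by move=> z; rewrite inE/= in_itv/= => z1; rewrite /b' -bE.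
  apply: continuous_subspaceT => z; apply/(@cvg_nbhsP _ R^o) => u uz.
  apply: cvgM; first exact: cvg_cst.
  apply: tail_integral_cvg => //; try by move=> *; exact: gauge_unit_point.
  by apply: cvg_comp uz _; exact: continuous_unit_point.
have covE x : rho x.1 x.2 = fine (\int[lebesgue_measure]_(r in `]0%R, +oo[)
    (covering_integrand p f B (0 - x) r)%:E)%E.
  rewrite /rho /grain_cov.
  have -> : grain_field B p N 0 0 = fun w => fine (N w (covering_grains B p 0)).
    by apply/funext => w'; exact: (@grain_fieldE _ _ _ hBmeas _ _ _ 0).
  have -> : grain_field B p N x.1 x.2 = fun w => fine (N w (covering_grains B p x)).
    by apply/funext => w'; exact: grain_fieldE.
  rewrite (poisson_random_measure_covariance hN)//=; last 4 first.
  - exact: measurable_covering_grains.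
  - exact: measurable_covering_grains.
  - exact: (covering_grains_lty _ alpha1 hc hf hftail).
  - exact: (covering_grains_lty _ alpha1 hc hf hftail).
  by rewrite (@grain_intensity_covering _ p B hBmeas F f).
apply/cvgrPdist_le => e0 e0_gt0.
have [e e01 ee0] : exists2 e : R, 0 < e <= 1 & e <= e0.
  exists (Num.min e0 1); last by rewrite ge_min lexx.
  by rewrite lt_min e0_gt0 ltr01 ge_min lexx orbT.
have [L sandwich] := covering_integral_sandwich hp hc hf hftail hBmeas hBbnd e01.
have := gauge_unbounded hp (Num.max L 0); apply: filterS => x.
rewrite gt_max => /andP[xL x0].
rewrite /b /w (grain_b_scaling _ hp alpha1 hBmeas hBbnd x0).
have [] := sandwich (0 - x).
  by rewrite /gauge/= !sub0r !normrN.
rewrite covE; set I := (\int[_]_(_ in _) _)%E.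
rewrite sub0r tail_integralN//; set J := tail_integral B p alpha x.
have J_fin : J \is a fin_num.
  rewrite /J (tail_integral_scale p alpha hBmeas x x0)// fin_numM//.
  rewrite ge0_fin_numE ?tail_integral_ge0// tail_integral_lty//.
  by rewrite (gauge_shift hp _ x0) (mulfV (lt0r_neq0 x0)).
have J_gt0 : 0 < fine J by rewrite fine_gt0// tail_integral_gt0//= ltey_eq J_fin.
rewrite -(fineK J_fin) -!EFinM => lo up.
have I_fin : I \is a fin_num.
  rewrite fin_numElt (lt_le_trans _ lo) ?ltNyr//.
  by rewrite (le_lt_trans up) ?ltry.
move: lo up; rewrite -(fineK I_fin) !lee_fin => lo up.
have D0 : 0 < c_f * fine J by rewrite mulr_gt0.
rewrite distrC ler_distl; apply/andP; split.
  rewrite ler_pdivlMr// (le_trans _ lo)// mulrA ler_pM2r// ler_pM2r//; lra.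
rewrite ler_pdivrMr// (le_trans up)// mulrA ler_pM2r// ler_pM2r//; lra.
Qed.
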